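(* Let $0<c<1$. For a sequence $(t_n)_{n\geq1}$ of positive reals define $F_n(z,w)=\big(z^2+c^{t_n^n}w,\ c^{t_n^n}z\big)$ and let $\Omega=\{(z,w)\in\mathbb{C}^2: F_n\circ\cdots\circ F_1(z,w)\to0\}$ be the non-autonomous basin of attraction at the origin. Then: (A) there exists a sequence $t_n\to2$ for which $\Omega$ is a Short $\mathbb{C}^2$; (B) there exists a sequence $t_n\to2$ for which $\Omega$ is a Fatou–Bieberbach domain.
   Context: A Fatou–Bieberbach domain is a proper subdomain of $\mathbb{C}^k$ that is biholomorphic to $\mathbb{C}^k$. Definition (Short $\mathbb{C}^k$): for $k\geq 2$, a domain $\Omega\subseteq\mathbb{C}^k$ is a Short $\mathbb{C}^k$ if it is the union of an increasing sequence of domains each biholomorphic to the unit ball of $\mathbb{C}^k$, its Kobayashi–Royden infinitesimal pseudometric vanishes identically, and it carries a non-constant plurisubharmonic function bounded above. *)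

(* Defs.v *)
(* C = R[i] (complex numbers over a realType R),
   viewed as a normed module over itself via the regular structure ^o;
   C^2 = C * C with the product (max-norm) topology, which is the usual topology. *)
From HB Require Import structures.
From mathcomp Require Import all_boot all_order all_algebra.
From mathcomp Require Import complex.
From mathcomp Require Import all_classical all_reals all_analysis.
Import numFieldNormedType.Exports numFieldTopology.Exports.
Import Order.TTheory GRing.Theory Num.Theory.

Set Implicit Arguments.
Unset Strict Implicit.
Unset Printing Implicit Defensive.

Local Open Scope classical_set_scope.
Local Open Scope ring_scope.
Local Open Scope complex_scope.

Notation Cx R := ((R[i])^o).
Notation C2 R := ((R[i])^o * (R[i])^o)%type.

Section several_complex.
Variable R : realType.

(* holomorphic = complex-(Frechet-)differentiable at every point of the set
   (differentiability over the field R[i] means the differential is C-linear) *)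
Definition holo_on (U : set (C2 R)) (f : C2 R -> C2 R) : Prop :=
  forall p, U p -> differentiable f p.

Definition holo1_on (D : set (Cx R)) (f : Cx R -> C2 R) : Prop :=
  forall z, D z -> differentiable f z.

Definition domain (U : set (C2 R)) : Prop :=
  open U /\ connected U /\ U !=set0.

Definition biholomorphic (U V : set (C2 R)) : Prop :=
  exists f g : C2 R -> C2 R,
    [/\ holo_on U f, holo_on V g,
        (forall p, U p -> V (f p) /\ g (f p) = p) &
        (forall q, V q -> U (g q) /\ f (g q) = q)].

Definition unit_ball : set (C2 R) :=
  [set p | `|(p.1 : R[i])| ^+ 2 + `|(p.2 : R[i])| ^+ 2 < 1].

Definition unit_disc : set (Cx R) := [set z | `|(z : R[i])| < 1].

Definition kobayashi_royden (U : set (C2 R)) (p v : C2 R) : \bar R :=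
  ereal_inf [set (r^-1)%:E | r in [set r : R | 0 < r /\
     exists phi : Cx R -> C2 R,
       [/\ holo1_on unit_disc phi,
           (forall z, unit_disc z -> U (phi z)),
           phi 0 = p &
           'D_1 phi 0 = (r%:C : R[i]) *: v]]].

Definition plurisubharmonic (U : set (C2 R)) (u : C2 R -> \bar R) : Prop :=
  [/\ (forall p, U p -> u p != +oo%E),
      (forall p, U p -> forall a : R, (u p < a%:E)%E ->
          \forall q \near p, (u q < a%:E)%E) &
      (forall p v : C2 R,
          (forall zeta : R[i], `|zeta| <= 1 -> U (p + zeta *: v)) ->
          (u p <= (((pi : R) *+ 2)^-1)%R%:E *
             \int[lebesgue_measure]_(th in `[0%R, ((pi : R) *+ 2)%R])
                u ((p + ((cos th) +i* (sin th) : R[i]) *: v)%R))%E)].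

Definition fatou_bieberbach (U : set (C2 R)) : Prop :=
  [/\ domain U, U != setT & biholomorphic U setT].

Definition short_C2 (U : set (C2 R)) : Prop :=
  [/\ domain U,
      (exists W : nat -> set (C2 R),
         [/\ (forall j, domain (W j) /\ biholomorphic (W j) unit_ball),
             (forall j, W j `<=` W j.+1) &
             \bigcup_j W j = U]),
      (forall p v, U p -> kobayashi_royden U p v = 0%E) &
      (exists u : C2 R -> \bar R,
         [/\ plurisubharmonic U u,
             (exists M : R, forall p, U p -> (u p <= M%:E)%E) &
             (exists p q, [/\ U p, U q & u p != u q])])].

Definition Fmap (c : R) (t : nat -> R) (n : nat) (p : C2 R) : C2 R :=
  let a : R[i] := (powR c (t n ^+ n))%:C in
  (((p.1 : R[i]) ^+ 2 + a * (p.2 : R[i])) : Cx R, (a * (p.1 : R[i])) : Cx R).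

Fixpoint Phi (c : R) (t : nat -> R) (n : nat) (p : C2 R) : C2 R :=
  match n with
  | 0 => p
  | m.+1 => Fmap c t m.+1 (Phi c t m p)
  end.

Definition basin (c : R) (t : nat -> R) : set (C2 R) :=
  [set p | Phi c t n p @[n --> \oo] --> (0 : C2 R)].

End several_complex.

(* Main.v *)
(**
Write [a_n = c ^ (t_n ^ n)]; both sequences are [t_n = 2 (n + 1) ^ (s / n)],
so that [t_n ^ n = 2 ^ n (n + 1) ^ s], with [s = 1] for (A) and [s = -1] for (B).

As [a_n] tends to [0], the maps [F_n] with [n] large contract a fixed ball, so the
basin is the increasing union of the preimages of this ball by the polynomial
automorphisms [F_n o ... o F_1]. Pulling back affine discs of the ball by these
automorphisms shows that the Kobayashi-Royden metric vanishes, since the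
derivatives of [F_n o ... o F_1] tend to [0] on the basin.

For (A), with [z_n] the first coordinate of the orbit, [a_(n+1) <= a_n ^ 2]
makes [2 ^ -n log (2 max (|z_n|, a_n))] eventually decreasing on the basin; the
limit is plurisubharmonic, at most [0], equal to [-oo] at the origin because
[log a_n / 2 ^ n] tends to [-oo], and finite on the positive real axis.

For (B), the linear parts of the [F_n] are multiples of the coordinate swap, and
dividing [F_n o ... o F_1] by its linear part leaves a composition of the shears
[(x, y) -> (x, y + e_k x ^ 2)] and [(x, y) -> (x + e_k y ^ 2, y)] with
[e_k = a_1 ... a_k / a_(k+1)]. Here [e_k] decays fast enough for the infinite
composition and its inverse to converge, to a biholomorphism from the basin
onto C^2. The Weierstrass theorem is only needed for limits of polynomial maps,
for which Cauchy estimates follow by averaging over roots of unity.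
*)
From HB Require Import structures.
From mathcomp Require Import all_boot all_order all_algebra.
From mathcomp Require Import complex.
From mathcomp Require Import all_classical all_reals all_analysis measurable_realfun.
From mathcomp Require Import ring lra zify.
Require Import Defs.
Import numFieldNormedType.Exports numFieldTopology.Exports.
Import Order.TTheory GRing.Theory Num.Theory.
Set Implicit Arguments.
Unset Strict Implicit.
Unset Printing Implicit Defensive.
Local Open Scope classical_set_scope.
Local Open Scope ring_scope.

(** Put [T_n = t_n ^ n = 2 ^ n (n + 1) ^ s]. The exponent of [c] in
    [e_(k+1) / e_k = a_(k+1) ^ 2 / a_(k+2)] is [2 T_(k+1) - T_(k+2) = 2 ^ (k+2) ((k+2) ^ s - (k+3) ^
    s)], so the sign of [s] separates the two cases. For [s = 1] it is negative, that is
    [a_(n+1) <= a_n ^ 2], and the linear term never outgrows the squaring; for [s = -1] it is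
    positive and unbounded, and the [e_k] die out.

    The obstacle in (B) is that the shear compositions must converge on the whole basin. A point of
    the basin without convergence would have an orbit governed by squaring, hence at most
    [(1/2) ^ (2 ^ k)] after a shift of index, and yet larger than the next [a_n]. As
    [2 ^ -n log a_n] tends to [0], the [a_n] decay too slowly for this. *)

Local Notation nm := Normc.normc.

(** * Moduli on C and C^2 *)

Section modulus.
Context {R : realType}.
Implicit Types (x y z : R[i]) (p q h : C2 R).

Lemma norm_nm z : `|z| = (nm z)%:C%C.
Proof. by rewrite normc_def; case: z. Qed.

Lemma nmD x y : nm (x + y) <= nm x + nm y.
Proof. exact: le_normcD. Qed.

Lemma nmN x : nm (- x) = nm x.
Proof. exact: normcN. Qed.

Lemma nmM x y : nm (x * y) = nm x * nm y.
Proof. exact: Normc.normcM. Qed.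

Lemma nm0 : nm (0 : R[i]) = 0.
Proof. exact: Normc.normc0. Qed.

Lemma nm1 : nm (1 : R[i]) = 1.
Proof. exact: Normc.normc1. Qed.

Lemma nm_ge0 x : 0 <= nm x.
Proof. by case: x => a b; rewrite sqrtr_ge0. Qed.

Lemma nm_eq0 x : (nm x == 0) = (x == 0).
Proof.
by apply/eqP/eqP => [/Normc.eq0_normc|->]; rewrite ?nm0.
Qed.

Lemma nmX x n : nm (x ^+ n) = nm x ^+ n.
Proof. by elim: n => [|n IH]; rewrite ?nm1 // !exprS nmM IH. Qed.

Lemma nmV x : nm x^-1 = (nm x)^-1.
Proof. exact: Normc.normcV. Qed.

Lemma nmB x y : nm (x - y) <= nm x + nm y.
Proof. by rewrite -(nmN y) nmD. Qed.

Lemma nmBC x y : nm (x - y) = nm (y - x).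
Proof. by rewrite -(nmN (x - y)) opprB. Qed.

Lemma nmR (a : R) : nm (a%:C%C) = `|a|.
Proof. by rewrite /= expr0n addr0 sqrtr_sqr. Qed.

Lemma nm_sum (I : Type) (r : seq I) (P : pred I) (F : I -> R[i]) :
  nm (\sum_(i <- r | P i) F i) <= \sum_(i <- r | P i) nm (F i).
Proof.
elim/big_rec2: _ => [|i a b _ H]; first by rewrite nm0.
by rewrite (le_trans (nmD _ _)) // lerD2l.
Qed.

Lemma nm_prod (I : Type) (r : seq I) (P : pred I) (F : I -> R[i]) :
  nm (\prod_(i <- r | P i) F i) = \prod_(i <- r | P i) nm (F i).
Proof. by apply: (big_morph _ nmM nm1). Qed.

Lemma nm_Re_le x : `|complex.Re x| <= nm x.
Proof.
by rewrite -lecR -norm_nm normc_ge_Re.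
Qed.

Lemma nm_Im_le x : `|complex.Im x| <= nm x.
Proof.
case: x => a b /=; rewrite -sqrtr_sqr ler_wsqrtr // lerDr sqr_ge0 //.
Qed.

Lemma nm_le_ReIm x : nm x <= `|complex.Re x| + `|complex.Im x|.
Proof.
case: x => a b /=; rewrite -[leRHS]ger0_norm ?addr_ge0 // -sqrtr_sqr.
rewrite ler_wsqrtr // sqrrD -!normrX !(ger0_norm (sqr_ge0 _)).
by rewrite lerD2r lerDl mulrn_wge0 // mulr_ge0.
Qed.

Lemma cvgn_dist (V : pseudoMetricNormedZmodType R) (u : nat -> V) (l : V) :
  u @ \oo --> l <->
  forall e, 0 < e -> exists n0, forall n, (n0 <= n)%N -> `|l - u n| < e.
Proof.
rewrite cvgrPdist_lt; split=> H e e0.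
  by have [n0 _ Hn] := H e e0; exists n0 => n /Hn.
by have [n0 Hn] := H e e0; exists n0.
Qed.

Lemma geometric_cvg0 (u : nat -> R) (c : R) (N : nat) : 0 <= c < 1 ->
  (forall n, 0 <= u n) -> (forall n, (N <= n)%N -> u n.+1 <= c * u n) ->
  u @ \oo --> 0.
Proof.
move=> /andP[c0 c1] u0 uS.
have bound k : u (N + k)%N <= c ^+ k * u N.
  elim: k => [|k IH]; first by rewrite addn0 expr0 mul1r.
  by rewrite addnS (le_trans (uS _ (leq_addr _ _))) // exprS -[leRHS]mulrA ler_wpM2l.
have G : (fun k => c ^+ k * u N) @ \oo --> 0.
  rewrite -[X in _ --> X](mul0r (u N)); apply: cvgMl.
  by apply: cvg_expr; rewrite ger0_norm.
apply/cvgn_dist => e /((cvgn_dist _ _).1 G)[k0 Hk].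
exists (N + k0)%N => n nk; have Nn : (N <= n)%N by rewrite (leq_trans _ nk) // leq_addr.
have /Hk : (k0 <= n - N)%N by rewrite leq_subRL.
rewrite !sub0r !normrN; apply: le_lt_trans; rewrite ger0_norm ?u0 //.
by rewrite -{1}(subnKC Nn) (le_trans (bound _)) // ler_norm.
Qed.

(** Real and imaginary parts only produce the limit; the rate [s] is then recovered with its exact
    constant, since uniform convergence is later read off from it. *)
Lemma complex_cauchy (u : nat -> R[i]) (s : nat -> R) :
  (forall n k, (n <= k)%N -> nm (u k - u n) <= s n) -> s @ \oo --> 0 ->
  exists l, forall n, nm (u n - l) <= s n.
Proof.
move=> us /cvgn_dist s0.
have s_small e : 0 < e -> exists n0, forall n, (n0 <= n)%N -> s n < e.
  move=> /s0[n0 H]; exists n0 => n /H; rewrite sub0r normrN.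
  by apply: le_lt_trans; rewrite ler_norm.
have cv (f : R[i] -> R) : (forall x y, f (x - y) = f x - f y) ->
    (forall x, `|f x| <= nm x) -> exists l : R, (f \o u) @ \oo --> l.
  move=> fB fle; suff : cvg ((f \o u) @ \oo) by move=> /cvg_ex.
  apply/cauchy_cvgP; apply: cauchy_exP => e /s_small[n0 s_n0].
  exists (f (u n0)); exists n0 => // k /= n0k.
  rewrite -ball_normE /= -fB (le_lt_trans (fle _)) //.
  by rewrite nmBC (le_lt_trans (us _ _ n0k)) ?s_n0.
have [a /cvgn_dist ua] := cv (@complex.Re R) (fun _ _ => raddfB _ _ _) nm_Re_le.
have [b /cvgn_dist ub] := cv (@complex.Im R) (fun _ _ => raddfB _ _ _) nm_Im_le.
exists (a +i* b)%C => n; apply/ler_addgt0Pr => e e0.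
have [m Hm] := ua (e / 2) (divr_gt0 e0 (ltr0Sn _ _)).
have [m' Hm'] := ub (e / 2) (divr_gt0 e0 (ltr0Sn _ _)).
pose k := maxn n (maxn m m').
have /us unk : (n <= k)%N by rewrite leq_maxl.
have {}/Hm uk : (m <= k)%N by rewrite /k maxnCA leq_maxl.
have {}/Hm' uk' : (m' <= k)%N by rewrite /k maxnA leq_maxr.
rewrite -(subrK (u k) (u n)) -addrA (le_trans (nmD _ _)) // lerD //.
  by rewrite nmBC.
rewrite (le_trans (nm_le_ReIm _)) // !raddfB /= -/(_ + _) [e]splitr.
by rewrite lerD // distrC ltW.
Qed.
End modulus.

(** The norm on [C2 R] takes values in [R[i]]; its real counterpart turns all estimates into
    inequalities in [R]. *)
Definition nm2 {R : realType} (p : C2 R) : R :=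
  Order.max (nm (p.1 : R[i])) (nm (p.2 : R[i])).

Section product_norm.
Context {R : realType}.
Implicit Types (x y z : R[i]) (p q h : C2 R).

Lemma norm_nm2 p : `|p| = (nm2 p)%:C%C.
Proof.
rewrite prod_normE /nm2 !norm_nm /Order.max.
by rewrite ltcR; case: ifP.
Qed.

Lemma nm2_lt p e : (nm2 p < e) = (nm (p.1 : R[i]) < e) && (nm (p.2 : R[i]) < e).
Proof. by rewrite /nm2 gt_max. Qed.

Lemma nm2_le p e :
  (nm2 p <= e) = (nm (p.1 : R[i]) <= e) && (nm (p.2 : R[i]) <= e).
Proof. by rewrite /nm2 ge_max. Qed.

Lemma nm2_fst p : nm (p.1 : R[i]) <= nm2 p.
Proof. by rewrite /nm2 le_max lexx. Qed.

Lemma nm2_snd p : nm (p.2 : R[i]) <= nm2 p.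
Proof. by rewrite /nm2 le_max lexx orbT. Qed.

Lemma nm2_ge0 p : 0 <= nm2 p.
Proof. by rewrite (le_trans (nm_ge0 _) (nm2_fst p)). Qed.

Lemma nm2D p q : nm2 (p + q) <= nm2 p + nm2 q.
Proof.
by rewrite nm2_le /= !(le_trans (nmD _ _)) // lerD ?nm2_fst ?nm2_snd.
Qed.

Lemma nm2N p : nm2 (- p) = nm2 p.
Proof. by rewrite /nm2 /= !nmN. Qed.

Lemma nm2BC p q : nm2 (p - q) = nm2 (q - p).
Proof. by rewrite -(nm2N (p - q)) opprB. Qed.

Lemma nm2_tri q p r : nm2 (p - r) <= nm2 (p - q) + nm2 (q - r).
Proof. by apply: le_trans (nm2D _ _); rewrite addrA subrK. Qed.

Lemma nm2Z (t : R[i]) p : nm2 (t *: p) = nm t * nm2 p.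
Proof. by rewrite /nm2 /= !nmM maxr_pMr ?nm_ge0. Qed.

Lemma nm2_00 : nm2 (0 : C2 R) = 0.
Proof. by apply/eqP; rewrite eq_le nm2_ge0 andbT nm2_le /= expr0n addr0 sqrtr0 lexx. Qed.

Lemma nm2_eq0 p : nm2 p <= 0 -> p = 0.
Proof.
rewrite nm2_le => /andP[a b]; case: p a b => x y /= a b; congr pair; apply/eqP.
  by rewrite -nm_eq0 eq_le a nm_ge0.
by rewrite -nm_eq0 eq_le b nm_ge0.
Qed.

Lemma gt0_complex (e : R[i]) : 0 < e -> exists2 e' : R, 0 < e' & e = e'%:C%C.
Proof.
case: e => a b; rewrite ltcE /= => /andP[/eqP -> a0]; by exists a.
Qed.

Lemma nbhs_nm2 p (A : set (C2 R)) : nbhs p A <->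
  exists2 e, 0 < e & forall q, nm2 (q - p) < e -> A q.
Proof.
split=> [/nbhs_ballP[e /= /gt0_complex[e' e0 ->] H]|[e e0 H]].
  exists e' => // q qp; apply: H.
  by rewrite -ball_normE /= norm_nm2 ltcR nm2BC.
apply/nbhs_ballP; exists e%:C%C => /=; first by rewrite ltcR.
by move=> q; rewrite -ball_normE /= norm_nm2 ltcR nm2BC; apply: H.
Qed.

Lemma cvg_nm2 (u : nat -> C2 R) p : u @ \oo --> p <->
  forall e, 0 < e -> exists n0, forall n, (n0 <= n)%N -> nm2 (u n - p) < e.
Proof.
split=> [H e e0|H A /nbhs_nm2[e /H[n0 Hn] eA]].
  have [|n0 _ Hn] := H [set q | nm2 (q - p) < e].
    by apply/nbhs_nm2; exists e.
  by exists n0 => n /Hn.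
by exists n0 => // n /= /Hn; apply: eA.
Qed.

Lemma cvg_nm2_unique (u : nat -> C2 R) p q :
  u @ \oo --> p -> u @ \oo --> q -> p = q.
Proof. by move=> up uq; apply: (cvg_unique _ up uq). Qed.

Lemma continuous_nm2 (f : C2 R -> C2 R) p : {for p, continuous f} <->
  forall e, 0 < e -> exists2 d, 0 < d &
    forall q, nm2 (q - p) < d -> nm2 (f q - f p) < e.
Proof.
split=> [H e e0|H A /nbhs_nm2[e /H[d d0 Hd] eA]].
  have /nbhs_nm2[d d0 Hd] : nbhs p (f @^-1` [set q | nm2 (q - f p) < e]).
    by apply: H; apply/nbhs_nm2; exists e.
  by exists d.
by apply/nbhs_nm2; exists d => // q /Hd; apply: eA.
Qed.

Lemma C2_cauchy (u : nat -> C2 R) (s : nat -> R) :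
  (forall n k, (n <= k)%N -> nm2 (u k - u n) <= s n) -> s @ \oo --> 0 ->
  exists l, forall n, nm2 (u n - l) <= s n.
Proof.
move=> us s0.
have [|a Ha] := @complex_cauchy R (fun n => (u n).1) s _ s0.
  by move=> n k /us; apply: le_trans (nm2_fst (u k - u n)).
have [|b Hb] := @complex_cauchy R (fun n => (u n).2) s _ s0.
  by move=> n k /us; apply: le_trans (nm2_snd (u k - u n)).
by exists (a, b) => n; rewrite nm2_le /= Ha Hb.
Qed.

(** A remainder that is quadratic near [a] is negligible to first order. The source [V] is abstract
    because the criterion serves both maps of [C2 R] and curves on [Cx R]. *)
Lemma is_diff_nm2 (V : normedModType R[i]) (nv : V -> R)
    (f : V -> C2 R) (a : V) (df : {linear V -> C2 R}) (C L r : R) :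
  (forall v, `|v| = (nv v)%:C%C) -> 0 < r ->
  (forall v, nm2 (df v) <= L * nv v) ->
  (forall v, nv v <= r ->
     nm2 (f (v + a) - f a - df v) <= C * nv v ^+ 2) ->
  is_diff a f df.
Proof.
move=> nvE r0 dfL fC.
have nv0 v : 0 <= nv v by rewrite -lecR -nvE normr_ge0.
have near0 d : 0 < d -> \forall v \near (0 : V), nv v < d.
  move=> d0; have d0' : 0 < d%:C%C by rewrite ltcR.
  apply: filterS (nbhsx_ballx (0 : V) _ d0') => v.
  by rewrite -ball_normE /= sub0r normrN nvE ltcR.
have dfc : continuous df.
  move=> x; apply/cvgrPdist_lt => e /gt0_complex[e' e0 ->].
  have L0 : 0 < `|L| + 1 by rewrite ltr_pwDr.
  have d0 : 0 < (e' / (`|L| + 1))%:C%C by rewrite ltcR divr_gt0.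
  apply: filterS (nbhsx_ballx x _ d0) => y.
  rewrite -ball_normE /= nvE ltcR ltr_pdivlMr // => xy.
  rewrite -linearB norm_nm2 ltcR (le_lt_trans (dfL _)) //.
  rewrite (le_lt_trans _ xy) // mulrC ler_wpM2l //.
  by rewrite (le_trans (ler_norm _)) // lerDl.
have dfo : f \o shift a = cst (f a) + df +o_ 0 id.
  apply/eqaddoP => e /gt0_complex[e' e0 ->].
  have C0 : 0 < `|C| + 1 by rewrite ltr_pwDr.
  have := near0 _ (divr_gt0 e0 C0).
  have := near0 _ r0.
  apply: filterS2 => v vr ve.
  rewrite norm_nm2 nvE -rmorphM lecR /= !fctE opprD addrA.
  rewrite (le_trans (fC _ (ltW vr))) // expr2 mulrA ler_wpM2r //.
  move: ve; rewrite ltr_pdivlMr // mulrC => /ltW; apply: le_trans.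
  by rewrite ler_wpM2r // (le_trans (ler_norm _)) // lerDl.
have dd := diff_unique dfc dfo.
split; last by [].
by apply/diff_locallyP; rewrite dd.
Qed.
End product_norm.

(** * Cauchy estimates and limits of polynomial maps *)

Section circle.
Context {R : realType}.
Implicit Types (q : {poly R[i]}) (t : R[i]).

Definition cis (a : R) : R[i] := (cos a +i* sin a)%C.

Lemma cisD a b : cis (a + b) = cis a * cis b.
Proof.
by rewrite /cis cosD sinD [sin a * _ + _]addrC.
Qed.

Lemma nm_cis a : nm (cis a) = 1.
Proof. by rewrite /= cos2Dsin2 sqrtr1. Qed.

Lemma cis0 : cis 0 = 1.
Proof. by rewrite /cis cos0 sin0. Qed.

Lemma cisMn a n : cis (a *+ n) = cis a ^+ n.
Proof. by elim: n => [|n IH]; rewrite ?mulr0n ?cis0 // mulrS exprS cisD IH. Qed.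

Lemma cis2pi : cis (pi *+ 2) = 1.
Proof.
have cpi : cis pi = -1.
  by apply/eqP; rewrite /cis cospi sinpi eq_complex /= oppr0 !eqxx.
by rewrite cisMn cpi sqrrN expr1n.
Qed.

Lemma cis_neq1 a : 0 < a < pi *+ 2 -> cis a != 1.
Proof.
move=> /andP[a0 a2]; apply/eqP => /(congr1 (@complex.Re R)) /=.
have sa : 0 < sin (a / 2).
  rewrite sin_gt0_pi // divr_gt0 //= ltr_pdivrMr //.
  by rewrite mulr_natr.
rewrite [a]splitr cosD -!expr2 cos2sin2 => /eqP.
rewrite -subr_eq0 => /eqP H; have := exprn_gt0 2 sa; lra.
Qed.

Definition croot (N : nat) : R[i] := cis (pi *+ 2 / N%:R).

Lemma nm_crootX N j : nm (croot N ^+ j) = 1.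
Proof. by rewrite nmX nm_cis expr1n. Qed.

Lemma crootX N : croot N ^+ N = 1.
Proof.
case: N => [|N]; first by rewrite expr0.
by rewrite /croot -cisMn -[_ *+ N.+1]mulr_natr divfK ?cis2pi // pnatr_eq0.
Qed.

Lemma crootX_neq1 N k : (0 < k < N)%N -> croot N ^+ k != 1.
Proof.
move=> /andP[k0 kN]; rewrite -cisMn; apply: cis_neq1.
have N0 : (0 : R) < N%:R by rewrite ltr0n (leq_trans _ kN).
have p0 : 0 < (pi : R) *+ 2 by rewrite mulrn_wgt0 ?pi_gt0.
rewrite -[_ *+ k]mulr_natr mulrAC; apply/andP; split.
  by rewrite divr_gt0 // mulr_gt0 // ltr0n.
by rewrite ltr_pdivrMr // ltr_pM2l // ltr_nat.
Qed.

(** Orthogonality of the characters of the cyclic group of order [N]; the exponent [N - k] stands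
    for [-k], so that only natural powers of the root occur. *)
Lemma sum_crootX N k i : (k < N)%N -> (i < N)%N ->
  \sum_(j < N) (croot N ^+ (i + (N - k))) ^+ j = (N%:R) *+ (i == k).
Proof.
move=> kN iN; have [->|ik] := eqVneq i k.
  rewrite subnKC ?(ltnW kN) // crootX.
  by under eq_bigr do rewrite expr1n; rewrite sumr_const card_ord.
have x1 : croot N ^+ (i + (N - k)) != 1.
  have [ki|ki] := ltnP k i.
    rewrite (_ : i + (N - k) = (i - k) + N)%N; last by lia.
    rewrite exprD crootX mulr1 crootX_neq1 // subn_gt0 ki /=.
    by rewrite (leq_ltn_trans (leq_subr _ _)).
  have {}ki : (i < k)%N by rewrite ltn_neqAle ik.
  rewrite crootX_neq1 // addn_gt0 subn_gt0 kN orbT /=.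
  by lia.
apply/eqP; rewrite mulr0n; have /eqP := subrX1 (croot N ^+ (i + (N - k))) N.
rewrite exprAC crootX expr1n subrr eq_sym mulf_eq0 subr_eq0.
by rewrite (negPf x1).
Qed.

(** A discrete Fourier transform: as [q] has at most [N] coefficients, averaging [q(r w^j) w^(-k j)]
    over [j] isolates the [k]-th one without aliasing. Only the sampled values need a bound, which
    the discrete Jensen inequality exploits. *)
Lemma coef_bound_roots q N k (r M : R) : (size q <= N)%N -> (k < N)%N ->
  0 <= r ->
  (forall j, (j < N)%N -> nm q.[r%:C%C * croot N ^+ j] <= M) ->
  nm q`_k * r ^+ k <= M.
Proof.
move=> qN kN r0 HM; pose w := croot N.
have N0 : (0 : R) < N%:R by rewrite ltr0n (leq_trans _ kN).
have E : \sum_(j < N) q.[r%:C%C * w ^+ j] * w ^+ ((N - k) * j) =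
         q`_k * (r%:C%C) ^+ k *+ N.
  transitivity (\sum_(j < N) \sum_(i < N)
      q`_i * (r%:C%C) ^+ i * (w ^+ (i + (N - k))) ^+ j).
    apply: eq_bigr => j _; rewrite (horner_coef_wide _ qN) mulr_suml.
    apply: eq_bigr => i _; rewrite exprMn -!mulrA; congr (_ * (_ * _)).
    by rewrite -!exprM -exprD mulnDl mulnC.
  rewrite exchange_big /= (bigD1 (Ordinal kN)) //= -mulr_sumr.
  rewrite sum_crootX // eqxx mulr_natr big1 ?addr0 // => i ik.
  by rewrite -mulr_sumr sum_crootX // (negPf (_ : _ != _)) ?mulr0.
have := congr1 (@nm R) E.
rewrite -mulr_natr !nmM nmX nmR ger0_norm // -[N%:R]/((1 *+ N)) -(rmorph_nat
    (real_complex R)) nmR ger0_norm ?ler0n //.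
move=> E'; rewrite -(ler_pM2r N0) -E' (le_trans (nm_sum _ _ _)) //.
rewrite [leRHS]mulr_natr -[X in M *+ X]card_ord -sumr_const ler_sum // => j _.
by rewrite nmM nm_crootX mulr1 HM.
Qed.

Lemma cauchy_coef q (k : nat) (r M : R) : 0 <= r ->
  (forall t, nm t = r -> nm q.[t] <= M) -> nm q`_k * r ^+ k <= M.
Proof.
move=> r0 HM; apply: (@coef_bound_roots q (maxn (size q) k.+1)) => //.
- exact: leq_maxl.
- exact: leq_maxr.
- by move=> j _; apply: HM; rewrite nmM nm_crootX mulr1 nmR ger0_norm.
Qed.

Lemma geo_sum_le2 (x : R) n : 0 <= x <= 1 / 2 -> \sum_(i < n) x ^+ i <= 2.
Proof.
move=> /andP[x0 x2].
have H := subrX1 x n.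
have : 0 <= x ^+ n by apply: exprn_ge0.
have S0 : 0 <= \sum_(i < n) x ^+ i by apply: sumr_ge0 => i _; apply: exprn_ge0.
nra.
Qed.

(** Cauchy estimates on the unit circle bound every coefficient by [M]; the terms of degree at least
    2 are dominated by a geometric series of ratio at most [1 / 2], whence the factor 2. *)
Lemma poly_taylor1 q (M : R) t : (forall t, nm t <= 1 -> nm q.[t] <= M) ->
  nm t <= 1 / 2 -> nm (q.[t] - q`_0 - q`_1 * t) <= 2 * M * nm t ^+ 2.
Proof.
move=> HM t2; have M0 : 0 <= M by rewrite (le_trans (nm_ge0 _) (HM 0 _)) // nm0.
have sq : (size q <= (size q).+2)%N by rewrite -addn2 leq_addr.
rewrite (horner_coef_wide t sq) 2!big_ord_recl expr0 mulr1 expr1 addrA.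
rewrite [X in nm X](_ : _ = \sum_(i < size q) q`_i.+2 * t ^+ i.+2); last first.
  rewrite -[q`_ord0]/(q`_0) -[q`_(lift ord0 ord0)]/(q`_1).
  rewrite -[X in _ + X - _ - _]/(\sum_(i < size q) q`_i.+2 * t ^+ i.+2).
  by move: (\sum_(i < _) _) => S; ring.
rewrite (le_trans (nm_sum _ _ _)) //.
have : \sum_(i < size q) M * nm t ^+ 2 * nm t ^+ i <= 2 * M * nm t ^+ 2.
  rewrite -mulr_sumr mulrC -mulrA ler_wpM2r ?mulr_ge0 ?exprn_ge0 ?nm_ge0 //.
  by rewrite geo_sum_le2 // nm_ge0.
apply: le_trans; apply: ler_sum => i _.
rewrite nmM nmX -mulrA -exprD !add2n.
rewrite ler_wpM2r ?exprn_ge0 ?nm_ge0 //.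
have := @cauchy_coef q i.+2 1 M ler01; rewrite expr1n mulr1; apply => z z1.
by apply: HM; rewrite z1.
Qed.
End circle.

Inductive polyfun {R : realType} : (C2 R -> R[i]) -> Prop :=
| polyfun_fst : polyfun (fun p => p.1)
| polyfun_snd : polyfun (fun p => p.2)
| polyfun_cst c : polyfun (fun=> c)
| polyfun_add f g : polyfun f -> polyfun g -> polyfun (fun p => f p + g p)
| polyfun_mul f g : polyfun f -> polyfun g -> polyfun (fun p => f p * g p).

(** The gradient [(A, B)] of [f] at [p], encoded by first-order coefficients on the complex lines
    through [p], so that one-variable Cauchy estimates apply to it. *)
Definition linear_part {R : realType} (f : C2 R -> R[i]) p (A B : R[i]) :=
  forall v : C2 R, exists2 q : {poly R[i]},
    (forall t : R[i], f (p + t *: v) = q.[t]) &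
    q`_1 = (v.1 : R[i]) * A + (v.2 : R[i]) * B.

Section polynomial_functions.
Context {R : realType}.
Implicit Types (f g : C2 R -> R[i]) (p v h : C2 R).

Lemma polyfun_linear_part f p : polyfun f -> exists A B, linear_part f p A B.
Proof.
elim=> {f} [||c|f g _ [A [B fAB]] _ [A' [B' gAB]]|f g _ [A [B fAB]] _ [A' [B' gAB]]].
- exists 1, 0 => v; exists ((p.1 : R[i])%:P + (v.1 : R[i]) *: 'X).
    by move=> t; rewrite !hornerE /= mulrC.
  by rewrite coefD coefC coefZ coefX /= add0r mulr1 mulr0 addr0.
- exists 0, 1 => v; exists ((p.2 : R[i])%:P + (v.2 : R[i]) *: 'X).
    by move=> t; rewrite !hornerE /= mulrC.
  by rewrite coefD coefC coefZ coefX /= add0r mulr1 mulr0 add0r.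
- exists 0, 0 => v; exists c%:P; first by move=> t; rewrite hornerE.
  by rewrite coefC /= !mulr0 addr0.
- exists (A + A'), (B + B') => v; have [q qE q1] := fAB v; have [r rE r1] := gAB v.
  exists (q + r); first by move=> t; rewrite hornerD qE rE.
  by rewrite coefD q1 r1; ring.
- exists (A * g p + f p * A'), (B * g p + f p * B') => v.
  have [q qE q1] := fAB v; have [r rE r1] := gAB v.
  exists (q * r); first by move=> t; rewrite hornerM qE rE.
  have q0 : q`_0 = f p by rewrite -horner_coef0 -qE scale0r addr0.
  have r0 : r`_0 = g p by rewrite -horner_coef0 -rE scale0r addr0.
  by rewrite coefM big_ord_recl big_ord1 /= q0 r0 q1 r1; ring.
Qed.

Lemma polyfun_bounded f (r : R) : polyfun f ->
  exists M, forall p, nm2 p <= r -> nm (f p) <= M.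
Proof.
elim=> {f} [||c|f g _ [A fA] _ [B gB]|f g _ [A fA] _ [B gB]].
- by exists r => p; apply: le_trans; apply: nm2_fst.
- by exists r => p; apply: le_trans; apply: nm2_snd.
- by exists (nm c).
- exists (A + B) => p pr; rewrite (le_trans (nmD _ _)) // lerD //; [exact: fA|exact: gB].
- by exists (A * B) => p pr; rewrite nmM ler_pM ?nm_ge0 ?fA ?gB.
Qed.

Lemma polyfunB f g : polyfun f -> polyfun g -> polyfun (fun p => f p - g p).
Proof.
move=> pf pg; rewrite (_ : (fun _ => _) = (fun p => f p + (-1) * g p)).
  by apply: polyfun_add => //; apply: polyfun_mul => //; apply: polyfun_cst.
by apply/funext => p; rewrite mulN1r.
Qed.

(** The one-variable coefficient estimate along the directions [(r, 0)] and [(0, r)]. *)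
Lemma linear_part_bound f p A B (r M : R) : linear_part f p A B -> 0 < r ->
  (forall h, nm2 h <= r -> nm (f (p + h)) <= M) ->
  nm A * r <= M /\ nm B * r <= M.
Proof.
move=> fAB r0 fM.
have bound v : nm2 v = r -> nm ((v.1 : R[i]) * A + (v.2 : R[i]) * B) <= M.
  move=> vr; have [q qE <-] := fAB v.
  have := @cauchy_coef R q 1 1 M ler01; rewrite expr1n mulr1; apply => t t1.
  by rewrite -qE fM // nm2Z t1 vr mul1r.
have nmr : nm (r%:C%C) = r by rewrite nmR gtr0_norm.
have nr0 : nm2 ((r%:C%C, 0) : C2 R) = r.
  by rewrite /nm2 -[LHS]/(Order.max (nm r%:C%C) (nm (0 : R[i]))) nmr nm0 max_l // ltW.
have n0r : nm2 ((0, r%:C%C) : C2 R) = r.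
  by rewrite /nm2 -[LHS]/(Order.max (nm (0 : R[i])) (nm r%:C%C)) nmr nm0 max_r // ltW.
split.
  by have := bound _ nr0; rewrite /= mul0r addr0 nmM nmr mulrC.
by have := bound _ n0r; rewrite /= mul0r add0r nmM nmr mulrC.
Qed.

Lemma linear_part_taylor f p A B (r M : R) h : linear_part f p A B -> 0 < r ->
  (forall h, nm2 h <= r -> nm (f (p + h)) <= M) -> nm2 h <= r / 2 ->
  nm (f (p + h) - f p - ((h.1 : R[i]) * A + (h.2 : R[i]) * B)) <=
    2 * M / r ^+ 2 * nm2 h ^+ 2.
Proof.
move=> fAB r0 fM hr.
have M0 : 0 <= M.
  by rewrite (le_trans (nm_ge0 _) (fM 0 _)) // nm2_00 ltW.
have [h0|h0] := eqVneq (nm2 h) 0.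
  have -> : h = 0 by apply: nm2_eq0; rewrite h0.
  rewrite addr0 subrr (_ : _ - _ = 0) ?nm0.
    by rewrite mulr_ge0 ?exprn_ge0 ?nm2_ge0 ?divr_ge0 ?mulr_ge0 ?exprn_ge0 ?(ltW r0).
  by rewrite /= !mul0r addr0 subrr.
have hp : 0 < nm2 h by rewrite lt_def h0 nm2_ge0.
(* Rescaling [h] to norm [r] makes [h] the point of parameter [s <= 1 / 2] on a line whose unit disc
   stays in the ball of radius [r]. *)
pose s := nm2 h / r; have s0 : 0 < s by rewrite divr_gt0.
have sC0 : s%:C%C != 0 :> R[i] by rewrite -nm_eq0 nmR gtr0_norm // gt_eqF.
have [q qE q1] := fAB ((s%:C%C)^-1 *: h).
have nms : nm (s%:C%C) = s by rewrite nmR gtr0_norm.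
have qs : q.[s%:C%C] = f (p + h) by rewrite -qE scalerA mulfV // scale1r.
have q0 : q`_0 = f p by rewrite -horner_coef0 -qE scale0r addr0.
have q1s : q`_1 * s%:C%C = (h.1 : R[i]) * A + (h.2 : R[i]) * B.
  rewrite q1 -[LHS]/(((s%:C%C)^-1 * (h.1 : R[i]) * A + (s%:C%C)^-1 * (h.2 : R[i]) * B)
      * s%:C%C).
  by rewrite -!mulrA -mulrDr mulrAC mulVf // mul1r.
rewrite -qs -q0 -q1s (_ : 2 * M / r ^+ 2 * nm2 h ^+ 2 = 2 * M * s ^+ 2); last first.
  by rewrite /s; field; rewrite gt_eqF.
have := @poly_taylor1 R q M s%:C%C; rewrite nms; apply.
  move=> t t1; rewrite -qE fM // scalerA nm2Z nmM nmV nms.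
  rewrite /s invf_div mulrA mulrVK ?unitfE // -[leRHS]mul1r ler_wpM2r // ltW //.
by rewrite /s ler_pdivrMr // mul1r mulrC.
Qed.

(** The differences [f k - f n] have linear parts of size at most [s n / r], so the gradients
    converge; the constant in the quadratic remainder does not depend on [n] and passes to the
    limit. *)
Lemma weierstrass_scalar (f : nat -> C2 R -> R[i]) g p (r M : R) (s : nat -> R) :
  0 < r -> (forall n, polyfun (f n)) ->
  (forall n h, nm2 h <= r -> nm (f n (p + h)) <= M) ->
  (forall n k h, (n <= k)%N -> nm2 h <= r -> nm (f k (p + h) - f n (p + h)) <= s n) ->
  (forall n h, nm2 h <= r -> nm (f n (p + h) - g (p + h)) <= s n) ->
  s @ \oo --> 0 ->
  exists A B, forall h, nm2 h <= r / 2 ->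
    nm (g (p + h) - g p - ((h.1 : R[i]) * A + (h.2 : R[i]) * B)) <=
    2 * M / r ^+ 2 * nm2 h ^+ 2.
Proof.
move=> r0 pf fM fk fg s0.
have [AB fAB] : exists AB : nat -> R[i] * R[i],
    forall n, linear_part (f n) p (AB n).1 (AB n).2.
  have H n : exists AB : R[i] * R[i], linear_part (f n) p AB.1 AB.2.
    by have [A [B H]] := polyfun_linear_part p (pf n); exists (A, B).
  by exists (fun n => projT1 (cid (H n))) => n; case: (cid (H n)).
have dAB n k : (n <= k)%N -> nm ((AB k).1 - (AB n).1) <= s n / r /\
    nm ((AB k).2 - (AB n).2) <= s n / r.
  move=> nk; have L : linear_part (fun q => f k q - f n q) p
      ((AB k).1 - (AB n).1) ((AB k).2 - (AB n).2).
    move=> v; have [q qE q1] := fAB k v; have [q' qE' q1'] := fAB n v.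
    exists (q - q'); first by move=> t; rewrite hornerD hornerN qE qE'.
    by rewrite coefB q1 q1'; ring.
  rewrite !ler_pdivlMr //; apply: (linear_part_bound L r0) => h hr.
  exact: fk.
have s0' : (fun n => s n / r) @ \oo --> 0.
  by rewrite -(mul0r r^-1); apply: cvgMl.
have [A HA] := complex_cauchy (fun n k nk => (dAB n k nk).1) s0'.
have [B HB] := complex_cauchy (fun n k nk => (dAB n k nk).2) s0'.
exists A, B => h hr; have r0' := ltW r0.
have hr' : nm2 h <= r by rewrite (le_trans hr) // ler_pdivrMr // ler_peMr // lerDl.
apply/ler_addgt0Pr => e e0.
(* Replacing [g] by [f n] costs [s n] for each of two values and [nm2 h * s n / r] for each of two
   partial derivatives. *)
have K0 : 0 < 2 + 2 * nm2 h / r by rewrite ltr_pwDl // divr_ge0 ?mulr_ge0 ?nm2_ge0.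
have /cvgn_dist/(_ _ (divr_gt0 e0 K0))[n /(_ n (leqnn _))] := s0.
rewrite sub0r normrN ltr_pdivlMr // => sn.
have {}sn : s n * (2 + 2 * nm2 h / r) <= e.
  by rewrite (le_trans _ (ltW sn)) // ler_wpM2r ?ler_norm // ltW.
have T := linear_part_taylor (fAB n) r0 (fM n) hr.
set a := f n (p + h) in T *; set b := f n p in T *.
have gb : nm (b - g p) <= s n.
  by have := fg n 0; rewrite addr0 nm2_00; apply; exact: ltW.
have ga : nm (a - g (p + h)) <= s n by exact: fg.
have h1 := nm2_fst h; have h2 := nm2_snd h.
have hA : nm ((h.1 : R[i]) * ((AB n).1 - A)) <= nm2 h * (s n / r).
  by rewrite nmM ler_pM ?nm_ge0.
have hB : nm ((h.2 : R[i]) * ((AB n).2 - B)) <= nm2 h * (s n / r).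
  by rewrite nmM ler_pM ?nm_ge0.
set X := _ - _ - _ in T.
rewrite (_ : _ - _ - _ = X + ((b - g p) - (a - g (p + h)) +
  ((h.1 : R[i]) * ((AB n).1 - A) + (h.2 : R[i]) * ((AB n).2 - B)))); last first.
  by rewrite /X; ring.
rewrite (le_trans (nmD _ _)) // lerD // (le_trans _ sn) //.
rewrite (le_trans (nmD _ _)) // (_ : s n * _ = (s n + s n) +
  (nm2 h * (s n / r) + nm2 h * (s n / r))); last by ring.
by rewrite lerD // ?(le_trans (nmB _ _)) ?(le_trans (nmD _ _)) ?lerD.
Qed.

Definition polymap (f : C2 R -> C2 R) :=
  polyfun (fun p => (f p).1) /\ polyfun (fun p => (f p).2).

Definition linear2 (A B : C2 R) (h : C2 R) : C2 R :=
  ((h.1 : R[i]) * A.1 + (h.2 : R[i]) * B.1, (h.1 : R[i]) * A.2 + (h.2 : R[i]) * B.2).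

Fact linear2_linear A B : linear (linear2 A B).
Proof.
move=> a u v; have E (X Y u1 u2 v1 v2 : R[i]) :
    (a * u1 + v1) * X + (a * u2 + v2) * Y =
    a * (u1 * X + u2 * Y) + (v1 * X + v2 * Y) by ring.
exact: (f_equal2 pair (E _ _ _ _ _ _) (E _ _ _ _ _ _)).
Qed.

HB.instance Definition _ A B :=
  GRing.isLinear.Build R[i] (C2 R) (C2 R) _ (linear2 A B) (linear2_linear A B).

Lemma weierstrass (f : nat -> C2 R -> C2 R) (g : C2 R -> C2 R) p (r M : R) (s : nat -> R) :
  0 < r -> (forall n, polymap (f n)) ->
  (forall n h, nm2 h <= r -> nm2 (f n (p + h)) <= M) ->
  (forall n k h, (n <= k)%N -> nm2 h <= r -> nm2 (f k (p + h) - f n (p + h)) <= s n) ->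
  (forall n h, nm2 h <= r -> nm2 (f n (p + h) - g (p + h)) <= s n) ->
  s @ \oo --> 0 ->
  differentiable g p.
Proof.
move=> r0 pf fM fk fg s0.
have [A1 [B1 H1]] := @weierstrass_scalar (fun n q => (f n q).1) (fun q => (g q).1)
  p r M s r0 (fun n => (pf n).1) (fun n h hr => le_trans (nm2_fst _) (fM n h hr))
  (fun n k h nk hr => le_trans (nm2_fst _) (fk n k h nk hr))
  (fun n h hr => le_trans (nm2_fst _) (fg n h hr)) s0.
have [A2 [B2 H2]] := @weierstrass_scalar (fun n q => (f n q).2) (fun q => (g q).2)
  p r M s r0 (fun n => (pf n).2) (fun n h hr => le_trans (nm2_snd _) (fM n h hr))
  (fun n k h nk hr => le_trans (nm2_snd _) (fk n k h nk hr))
  (fun n h hr => le_trans (nm2_snd _) (fg n h hr)) s0.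
have : is_diff p g (linear2 (A1, A2) (B1, B2)).
  apply: (@is_diff_nm2 R _ nm2 g p (linear2 (A1, A2) (B1, B2)) (2 * M / r ^+ 2)
    (nm A1 + nm A2 + (nm B1 + nm B2)) (r / 2)).
  - exact: norm_nm2.
  - by rewrite divr_gt0.
  - move=> v; have v1 := nm2_fst v; have v2 := nm2_snd v.
    have H (A B : R[i]) K : nm A + nm B <= K ->
        nm ((v.1 : R[i]) * A + (v.2 : R[i]) * B) <= K * nm2 v.
      move=> ABK; rewrite (le_trans (nmD _ _)) // !nmM.
      rewrite (le_trans (lerD (ler_wpM2r (nm_ge0 A) v1) (ler_wpM2r (nm_ge0 B) v2))) //.
      by rewrite -mulrDr mulrC ler_wpM2r ?nm2_ge0.
    by rewrite nm2_le !H //= lerD // ?lerDl ?lerDr nm_ge0.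
  - move=> v vr; rewrite [v + p]addrC nm2_le; apply/andP; split.
      exact: H1.
    exact: H2.
by case.
Qed.

(** The Weierstrass theorem for a constant sequence, with error zero. *)
Lemma polymap_differentiable (f : C2 R -> C2 R) p : polymap f -> differentiable f p.
Proof.
move=> [f1 f2]; have [M1 H1] := polyfun_bounded (nm2 p + 1) f1.
have [M2 H2] := polyfun_bounded (nm2 p + 1) f2.
apply: (@weierstrass (fun=> f) f p 1 (Order.max M1 M2) (fun=> 0)) => //.
- move=> _ h h1; have ph : nm2 (p + h) <= nm2 p + 1.
    by rewrite (le_trans (nm2D _ _)) // lerD2l.
  by rewrite nm2_le !le_max H1 // H2 // orbT.
- by move=> _ _ h _ _; rewrite subrr nm2_00.
- by move=> _ h _; rewrite subrr nm2_00.
- exact: cvg_cst.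
Qed.

End polynomial_functions.

(** * The basin as an increasing union of balls *)

Section polynomial_curves.
Context {R : realType}.

Definition linear1 (w : C2 R) (z : Cx R) : C2 R :=
  ((z : R[i]) * w.1, (z : R[i]) * w.2).

Fact linear1_linear w : linear (linear1 w).
Proof.
move=> a u v.
have E (x u1 v1 : R[i]) : (a * u1 + v1) * x = a * (u1 * x) + v1 * x by ring.
exact: (f_equal2 pair (E _ _ _) (E _ _ _)).
Qed.

HB.instance Definition _ w :=
  GRing.isLinear.Build R[i] (Cx R) (C2 R) _ (linear1 w) (linear1_linear w).

Lemma poly_unit_disc_bounded (q : {poly R[i]}) :
  exists M, forall t, nm t <= 1 -> nm q.[t] <= M.
Proof.
exists (\sum_(i < size q) nm q`_i) => t t1; rewrite horner_coef.
rewrite (le_trans (nm_sum _ _ _)) // ler_sum // => i _.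
by rewrite nmM nmX ler_piMr ?nm_ge0 // exprn_ile1 ?nm_ge0.
Qed.

Lemma is_diff_poly_curve (q1 q2 : {poly R[i]}) (z : Cx R) :
  is_diff z (fun t : Cx R => (q1.[t], q2.[t]) : C2 R)
    (linear1 ((q1 \Po ('X + z%:P))`_1, (q2 \Po ('X + z%:P))`_1)).
Proof.
set r1 := q1 \Po _; set r2 := q2 \Po _.
have r1E t : q1.[t + z] = r1.[t] by rewrite horner_comp !hornerE.
have r2E t : q2.[t + z] = r2.[t] by rewrite horner_comp !hornerE.
have [M1 H1] := poly_unit_disc_bounded r1.
have [M2 H2] := poly_unit_disc_bounded r2.
apply: (@is_diff_nm2 R (Cx R) (@nm R) (fun t : Cx R => (q1.[t], q2.[t]) : C2 R) z
    (linear1 (r1`_1, r2`_1)) (2 * Order.max M1 M2)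
  (nm r1`_1 + nm r2`_1) (1 / 2)).
- exact: norm_nm.
- by rewrite divr_gt0.
- move=> v; rewrite nm2_le /= -!/(nm _) !nmM ![nm v * _]mulrC.
  by rewrite !ler_wpM2r ?nm_ge0 // ?lerDl ?lerDr nm_ge0.
move=> v v2; rewrite nm2_le; apply/andP; split.
  have -> : (((q1.[v + z], q2.[v + z]) : C2 R) - (q1.[z], q2.[z]) -
      linear1 (r1`_1, r2`_1) v).1 = r1.[v] - r1`_0 - r1`_1 * v :> R[i].
    by rewrite -horner_coef0 -!r1E add0r [r1`_1 * _]mulrC.
  rewrite (le_trans (poly_taylor1 H1 v2)) // ler_wpM2r ?exprn_ge0 ?nm_ge0 //.
  by rewrite ler_wpM2l // le_max lexx.
have -> : (((q1.[v + z], q2.[v + z]) : C2 R) - (q1.[z], q2.[z]) -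
    linear1 (r1`_1, r2`_1) v).2 = r2.[v] - r2`_0 - r2`_1 * v :> R[i].
  by rewrite -horner_coef0 -!r2E add0r [r2`_1 * _]mulrC.
rewrite (le_trans (poly_taylor1 H2 v2)) // ler_wpM2r ?exprn_ge0 ?nm_ge0 //.
by rewrite ler_wpM2l // le_max lexx orbT.
Qed.

Lemma poly_curve_derive0 (q1 q2 : {poly R[i]}) :
  'D_1 (fun t : Cx R => (q1.[t], q2.[t]) : C2 R) 0 = (q1`_1, q2`_1).
Proof.
have [dq E] := is_diff_poly_curve q1 q2 0.
rewrite deriveE // E addr0 !comp_polyXr.
by rewrite /linear1 /= !mul1r.
Qed.

Lemma poly_curve_holo (q1 q2 : {poly R[i]}) D :
  holo1_on D (fun t : Cx R => (q1.[t], q2.[t]) : C2 R).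
Proof. by move=> z _; have [] := is_diff_poly_curve q1 q2 z. Qed.

End polynomial_curves.

Section star_shaped.
Context {R : realType}.
Implicit Types (p q : C2 R) (A U V : set (C2 R)).

Lemma segment_continuous p : continuous (fun t : R => t%:C%C *: p : C2 R).
Proof.
move=> t A /nbhs_nm2[e e0 eA].
have P0 : 0 < nm2 p + 1 by rewrite ltr_wpDl // nm2_ge0.
apply: filterS (nbhsx_ballx t _ (divr_gt0 e0 P0)) => s.
rewrite -ball_normE /= distrC ltr_pdivlMr // => st; apply: eA.
rewrite -scalerBl -rmorphB nm2Z nmR (le_lt_trans _ st) //.
by rewrite ler_wpM2l // lerDl.
Qed.

Lemma star_connected A :
  (forall p, A p -> forall t : R, 0 <= t <= 1 -> A (t%:C%C *: p)) -> connected A.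
Proof.
move=> starA.
have -> : A = \bigcup_(p in A) [set (t%:C%C *: p : C2 R) | t in `[0, 1]%classic].
  apply/seteqP; split=> [p Ap|_ [p Ap [t /= t01 <-]]].
    by exists p => //; exists 1; rewrite ?scale1r //= in_itv /= ler01 lexx.
  by apply: starA => //; move: t01; rewrite in_itv.
apply: bigcup_connected.
  exists 0 => p Ap; exists 0; first by rewrite /= in_itv /= ler01 lexx.
  by rewrite scale0r.
move=> p Ap; apply: connected_continuous_connected.
  exact: segment_connected.
by apply: continuous_subspaceT => t; apply: segment_continuous.
Qed.

Lemma holo_continuous U (f : C2 R -> C2 R) :
  holo_on U f -> {in U, continuous f}.
Proof. by move=> hf p /set_mem Up; apply: differentiable_continuous; apply: hf. Qed.

Lemma biholomorphic_domain U V f g :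
  holo_on U f -> holo_on V g ->
  (forall p, U p -> V (f p) /\ g (f p) = p) ->
  (forall q, V q -> U (g q) /\ f (g q) = q) ->
  connected V -> connected U.
Proof.
move=> hf hg UV VU cV; have -> : U = [set g q | q in V].
  apply/seteqP; split=> [p Up|_ [q Vq <-]]; last by case: (VU _ Vq).
  by exists (f p); case: (UV _ Up).
apply: connected_continuous_connected => //.
by apply: continuous_in_subspaceT; apply: holo_continuous.
Qed.

End star_shaped.

Section euclidean_ball.
Context {R : realType}.
Implicit Types (p q : C2 R).

Definition sqnorm p : R := nm (p.1 : R[i]) ^+ 2 + nm (p.2 : R[i]) ^+ 2.

Lemma sqnorm_ge0 p : 0 <= sqnorm p.
Proof. by rewrite addr_ge0 ?exprn_ge0 ?nm_ge0. Qed.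

Lemma sqnormZ (t : R[i]) p : sqnorm (t *: p) = nm t ^+ 2 * sqnorm p.
Proof. by rewrite /sqnorm /= !nmM !exprMn mulrDr. Qed.

Lemma unit_ballE p : unit_ball p <-> sqnorm p < 1.
Proof.
have E : (`|(p.1 : R[i])| ^+ 2 + `|(p.2 : R[i])| ^+ 2 < 1) = (sqnorm p < 1).
  by rewrite -[RHS]ltcR rmorphD !rmorphXn /= -!norm_nm.
by rewrite /unit_ball /= E.
Qed.

Lemma nm2_sqnorm p : nm2 p ^+ 2 <= sqnorm p.
Proof.
rewrite /nm2 /Order.max; case: ifP => _.
  by rewrite lerDr exprn_ge0 ?nm_ge0.
by rewrite lerDl exprn_ge0 ?nm_ge0.
Qed.

Lemma sqnorm_nm2 p : sqnorm p <= 2 * nm2 p ^+ 2.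
Proof.
rewrite mulr_natl mulr2n lerD // lerXn2r ?nnegrE ?nm_ge0 ?nm2_ge0 //.
  exact: nm2_fst.
exact: nm2_snd.
Qed.

Lemma open_sqnorm_lt (s : R) : open [set p | sqnorm p < s].
Proof.
rewrite openE => p /= ps; apply/nbhs_nm2.
have N0 := nm2_ge0 p.
have K0 : 0 < 4 * nm2 p + 2 by rewrite ltr_wpDl // mulr_ge0.
have S0 : 0 < s - sqnorm p by rewrite subr_gt0.
(* Moving a coordinate by [d <= 1] raises its squared modulus by at most [d (2 nm2 p + 1)]; the two
   coordinates together give the denominator. *)
exists (Order.min 1 ((s - sqnorm p) / (4 * nm2 p + 2))).
  by rewrite lt_min ltr01 divr_gt0.
move=> q; rewrite lt_min => /andP[q1]; rewrite ltr_pdivlMr // => qs.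
have bound (x y : R[i]) : nm x <= nm2 p -> nm (y - x) <= nm2 (q - p) ->
    nm y ^+ 2 <= nm x ^+ 2 + nm2 (q - p) * (2 * nm2 p + 1).
  move=> xp yx; have := nm_ge0 x; have := nm_ge0 y; have := nm2_ge0 (q - p).
  have : nm y <= nm (y - x) + nm x by rewrite -{1}(subrK x y) nmD.
  nra.
have b1 := bound _ _ (nm2_fst p) (nm2_fst (q - p)).
have b2 := bound _ _ (nm2_snd p) (nm2_snd (q - p)).
rewrite /= /sqnorm; move: qs; rewrite {1}/sqnorm.
by move: b1 b2; lra.
Qed.

End euclidean_ball.

(** * The maps [F_n], their inverses and the stages of the basin *)

Section henon.
Context {R : realType}.
Implicit Types (a : R) (p q v w : C2 R).

Definition henon a p : C2 R :=
  ((p.1 : R[i]) ^+ 2 + a%:C%C * (p.2 : R[i]), a%:C%C * (p.1 : R[i])).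

Definition henonV a q : C2 R :=
  (a%:C%C^-1 * (q.2 : R[i]),
   a%:C%C^-1 * ((q.1 : R[i]) - (a%:C%C^-1 * (q.2 : R[i])) ^+ 2)).

Lemma realC_neq0 a : 0 < a -> a%:C%C != 0 :> R[i].
Proof. by move=> a0; rewrite -nm_eq0 nmR gtr0_norm // gt_eqF. Qed.

Lemma henonK a : 0 < a -> cancel (henon a) (henonV a).
Proof.
move=> /realC_neq0 a0 [x y]; rewrite /henon /henonV /=; congr (_, _).
  by rewrite mulKf.
by rewrite mulKf // addrAC subrr add0r mulKf.
Qed.

Lemma henonVK a : 0 < a -> cancel (henonV a) (henon a).
Proof.
move=> /realC_neq0 a0 [x y]; rewrite /henon /henonV /=; congr (_, _).
  by rewrite mulVKf // addrC subrK.
by rewrite mulVKf.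
Qed.

(** By [|z^2 + a w|^2 <= 2 |z|^4 + 2 a^2 |w|^2] and [|z|^2 < 1 / 4], the left side is at most
    [9/16 |z|^2 + 1/8 |w|^2]. *)
Lemma sqnorm_henon a p : 0 <= a <= 1 / 4 -> sqnorm p < 1 / 4 ->
  sqnorm (henon a p) <= 3 / 4 * sqnorm p.
Proof.
move=> /andP[a0 a4]; rewrite /sqnorm /= nmM nmR ger0_norm //.
have := nmD ((p.1 : R[i]) ^+ 2) (a%:C%C * (p.2 : R[i])).
rewrite nmM nmR ger0_norm // nmX.
set z := nm (p.1 : R[i]); set w := nm (p.2 : R[i]); set u := nm _.
have : 0 <= z by apply: nm_ge0. have : 0 <= w by apply: nm_ge0.
have : 0 <= u by apply: nm_ge0.
move=> u0 w0 z0 uzw zw.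
have a2 : a ^+ 2 <= 1 / 16 by nra.
have u2 : u ^+ 2 <= (z ^+ 2 + a * w) ^+ 2 by nra.
have v2 : (z ^+ 2 + a * w) ^+ 2 <= 2 * (z ^+ 2) ^+ 2 + 2 * (a ^+ 2 * w ^+ 2).
  have := sqr_ge0 (z ^+ 2 - a * w); nra.
have z4 : (z ^+ 2) ^+ 2 <= 1 / 4 * z ^+ 2.
  have := sqr_ge0 z; have := sqr_ge0 w; nra.
have w4 : a ^+ 2 * w ^+ 2 <= 1 / 16 * w ^+ 2 by have := sqr_ge0 w; nra.
have z5 : (a * z) ^+ 2 <= 1 / 16 * z ^+ 2.
  by rewrite exprMn; have := sqr_ge0 z; nra.
have := sqr_ge0 z; have := sqr_ge0 w; lra.
Qed.

Fixpoint horbit (a : nat -> R) n p : C2 R :=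
  if n is m.+1 then henon (a n) (horbit a m p) else p.

Fixpoint horbitV (a : nat -> R) n q : C2 R :=
  if n is m.+1 then horbitV a m (henonV (a n) q) else q.

Definition orbit_basin (a : nat -> R) : set (C2 R) :=
  [set p | horbit a n p @[n --> \oo] --> (0 : C2 R)].

Lemma polymap_henon a (f : C2 R -> C2 R) :
  polymap f -> polymap (fun p => henon a (f p)).
Proof.
move=> [f1 f2]; split => /=.
  by apply: polyfun_add; [exact: polyfun_mul|apply: polyfun_mul => //; exact: polyfun_cst].
by apply: polyfun_mul => //; exact: polyfun_cst.
Qed.

Lemma polymap_henonV a (f : C2 R -> C2 R) :
  polymap f -> polymap (fun p => henonV a (f p)).
Proof.
move=> [f1 f2].
have g : polyfun (fun p => a%:C%C^-1 * ((f p).2 : R[i])).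
  by apply: polyfun_mul => //; exact: polyfun_cst.
split => //=; apply: polyfun_mul; first exact: polyfun_cst.
by apply: polyfunB => //; exact: polyfun_mul.
Qed.

Lemma polymap_id : polymap (fun p : C2 R => p).
Proof. by split; [exact: polyfun_fst|exact: polyfun_snd]. Qed.

Lemma polymapZ (c : R[i]) (f : C2 R -> C2 R) :
  polymap f -> polymap (fun p => c *: f p).
Proof.
by move=> [f1 f2]; split; apply: polyfun_mul => //; exact: polyfun_cst.
Qed.

Lemma polymap_orbit (a : nat -> R) n (f : C2 R -> C2 R) :
  polymap f -> polymap (fun p => horbit a n (f p)).
Proof. by move=> pf; elim: n => [|n IH] //=; exact: polymap_henon. Qed.

Lemma polymap_orbitV (a : nat -> R) n (f : C2 R -> C2 R) :
  polymap f -> polymap (fun p => horbitV a n (f p)).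
Proof. by elim: n f => [|n IH] f pf //=; apply: (IH (fun p => henonV _ (f p))); exact:
    polymap_henonV. Qed.

Section positive_coefficients.
Variable a : nat -> R.
Hypothesis a_gt0 : forall n, 0 < a n.

Lemma orbitK n : cancel (horbit a n) (horbitV a n).
Proof. by elim: n => [|n IH] p //=; rewrite henonK ?IH. Qed.

Lemma orbitVK n : cancel (horbitV a n) (horbit a n).
Proof. by elim: n => [|n IH] p //=; rewrite IH henonVK. Qed.

Lemma orbit0 n : horbit a n 0 = 0.
Proof.
by elim: n => [|n IH] //=; rewrite IH /henon /= expr0n /= !mulr0 addr0.
Qed.

Lemma orbit_continuous n : continuous (horbit a n).
Proof.
move=> p; apply: differentiable_continuous; apply: polymap_differentiable.
exact: (@polymap_orbit a n _ polymap_id).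
Qed.

(** The preimage of the Euclidean ball of radius [1 / 2], which [sqnorm_henon] contracts as soon as
    the next coefficient is at most [1 / 4]. *)
Definition stage n : set (C2 R) := [set p | sqnorm (horbit a n p) < 1 / 4].

Lemma open_stage n : open (stage n).
Proof.
apply: (@open_comp _ _ (horbit a n) [set q | sqnorm q < 1 / 4]).
  by move=> p _; exact: orbit_continuous.
exact: open_sqnorm_lt.
Qed.

Lemma stage_origin n : stage n 0.
Proof.
rewrite /stage /= orbit0 (le_lt_trans (sqnorm_nm2 _)) // nm2_00 expr0n /= mulr0.
by rewrite divr_gt0.
Qed.

Lemma stage_biholomorphic n : exists f g : C2 R -> C2 R, [/\ holo_on (stage n) f,
  holo_on (@unit_ball R) g,
  (forall p, stage n p -> unit_ball (f p) /\ g (f p) = p) &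
  (forall q, unit_ball q -> stage n (g q) /\ f (g q) = q)].
Proof.
have nm2n : nm (2%:R : R[i]) = 2 by rewrite -(rmorph_nat (real_complex R)) nmR ger0_norm.
have n2 : (2%:R : R[i]) != 0 by rewrite -nm_eq0 nm2n.
exists (fun p => 2%:R *: horbit a n p), (fun q => horbitV a n (2%:R^-1 *: q)); split.
- move=> p _; apply: polymap_differentiable; apply: polymapZ.
  exact: (@polymap_orbit a n _ polymap_id).
- move=> p _; apply: polymap_differentiable; apply: polymap_orbitV.
  exact: polymapZ polymap_id.
- move=> p; rewrite /stage /= => pn; split.
    by apply/unit_ballE; rewrite sqnormZ nm2n; lra.
  by rewrite scalerA mulVf // scale1r orbitK.
- move=> q /unit_ballE q1; split; last first.
    by rewrite orbitVK scalerA mulfV // scale1r.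
  by rewrite /stage /= orbitVK sqnormZ nmV nm2n; lra.
Qed.

Lemma stage_domain n : domain (stage n).
Proof.
split; first exact: open_stage.
split; last by exists 0; exact: stage_origin.
have [f [g [hf hg fg gf]]] := stage_biholomorphic n.
apply: (biholomorphic_domain hf hg fg gf); apply: star_connected.
move=> p /unit_ballE p1 t /andP[t0 t1]; apply/unit_ballE.
rewrite sqnormZ nmR ger0_norm // (le_lt_trans _ p1) //.
by rewrite ler_piMl ?sqnorm_ge0 // exprn_ile1.
Qed.

Variable J : nat.
Hypothesis aJ : forall n, (J <= n)%N -> a n <= 1 / 4.

Lemma stage_step n p : (J <= n.+1)%N -> stage n p ->
  sqnorm (horbit a n.+1 p) <= 3 / 4 * sqnorm (horbit a n p).
Proof. by move=> Jn pn; rewrite /= sqnorm_henon // ltW //= aJ. Qed.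

Lemma stage_subset n m p : (J <= n)%N -> (n <= m)%N -> stage n p -> stage m p.
Proof.
move=> Jn /subnKC <- pn; elim: (m - n)%N => [|k IH]; first by rewrite addn0.
rewrite addnS /stage /= -[henon _ _]/(horbit a (n + k).+1 p).
rewrite (le_lt_trans (stage_step _ IH)) //.
  by rewrite (leq_trans Jn) // -addnS leq_addr.
by move: IH; rewrite /stage /=; have := sqnorm_ge0 (horbit a (n + k) p); lra.
Qed.

Lemma stage_orbit_small n p k : (J <= n)%N -> stage n p ->
  sqnorm (horbit a (n + k) p) <= (3 / 4) ^+ k / 4.
Proof.
move=> Jn pn; elim: k => [|k IH]; first by rewrite addn0 expr0 ltW.
rewrite addnS (le_trans (stage_step _ _)) //.
- by rewrite (leq_trans Jn) // -addnS leq_addr.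
- by apply: stage_subset pn => //; rewrite leq_addr.
by rewrite exprS -[leRHS]mulrA ler_wpM2l // divr_ge0.
Qed.

Lemma basin_stage p : orbit_basin a p -> exists n0, forall n, (n0 <= n)%N -> stage n p.
Proof.
move=> /cvg_nm2/(_ (1 / 4))[|n0 H]; first by rewrite divr_gt0.
exists n0 => n /H; rewrite subr0 /stage /= => pn.
rewrite (le_lt_trans (sqnorm_nm2 _)) //.
have := nm2_ge0 (horbit a n p); nra.
Qed.

Lemma stage_basin n p : (J <= n)%N -> stage n p -> orbit_basin a p.
Proof.
move=> Jn pn; apply/cvg_nm2 => e e0.
have : (fun k => (3 / 4 : R) ^+ k) @ \oo --> 0.
  by apply: cvg_expr; rewrite ger0_norm // ltr_pdivrMr // mul1r ltr_nat.
move=> /cvgn_dist/(_ (e ^+ 2) (exprn_gt0 2 e0))[k0 H].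
exists (n + k0)%N => m nm_; rewrite subr0.
have /H : (k0 <= m - n)%N by rewrite leq_subRL // (leq_trans _ nm_) // leq_addr.
rewrite sub0r normrN => Hk.
have := stage_orbit_small (m - n) Jn pn.
rewrite subnKC ?(leq_trans _ nm_) ?leq_addr // => Hm.
rewrite -(@ltr_pXn2r _ 2%N) ?nnegrE ?nm2_ge0 ?(ltW e0) //.
rewrite (le_lt_trans (nm2_sqnorm _)) // (le_lt_trans Hm) // (le_lt_trans _ Hk) //.
have : 0 <= (3 / 4 : R) ^+ (m - n) by rewrite exprn_ge0.
by move=> k0'; rewrite ger0_norm // ler_pdivrMr //; lra.
Qed.

(** A convergent orbit eventually enters the ball, and contraction keeps it there from index [J] on.
    Earlier stages are left out, since they need not lie in the basin. *)
Lemma basin_bigcup : \bigcup_j stage (J + j) = orbit_basin a.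
Proof.
apply/seteqP; split=> [p [j _]|p /basin_stage[n0 H]].
  by apply: stage_basin; rewrite leq_addr.
by exists n0 => //; apply: H; rewrite leq_addl.
Qed.

Lemma basin_domain : domain (orbit_basin a).
Proof.
rewrite -basin_bigcup; split.
  by apply: bigcup_open => j _; exact: open_stage.
split; last by exists 0; exists 0%N => //; exact: stage_origin.
apply: bigcup_connected; first by exists 0 => j _; exact: stage_origin.
by move=> j _; have [_ []] := stage_domain (J + j).
Qed.

(* The image of [v] by the derivative at [p] of [horbit a n]. *)
Fixpoint tangent p v n : C2 R :=
  if n is m.+1 then
    let z := (horbit a m p).1 : R[i] in let w := tangent p v m in
    (2 * z * (w.1 : R[i]) + (a n)%:C%C * (w.2 : R[i]), (a n)%:C%C * (w.1 : R[i]))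
  else v.

(** Pulls back the whole first-order jet: from the orbit point and [r] times its tangent vector to
    [p] and [r] times [v]. Reading jets from polynomial coefficients replaces the chain rule. *)
Lemma orbitV_curve n p v (r : R[i]) (q1 q2 : {poly R[i]}) :
  q1`_0 = (horbit a n p).1 -> q2`_0 = (horbit a n p).2 ->
  q1`_1 = r * ((tangent p v n).1 : R[i]) -> q2`_1 = r * ((tangent p v n).2 : R[i]) ->
  exists r1 r2 : {poly R[i]},
    [/\ forall t, horbitV a n (q1.[t], q2.[t]) = (r1.[t], r2.[t]),
        r1`_0 = p.1, r2`_0 = p.2, r1`_1 = r * (v.1 : R[i]) & r2`_1 = r * (v.2 : R[i])].
Proof.
elim: n q1 q2 => [|n IH] q1 q2 /= q10 q20 q11 q21; first by exists q1, q2.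
have a0 := realC_neq0 (a_gt0 n.+1).
pose s1 := (a n.+1)%:C%C^-1 *: q2; pose s2 := (a n.+1)%:C%C^-1 *: (q1 - s1 ^+ 2).
have s10 : s1`_0 = (horbit a n p).1 by rewrite coefZ q20 mulKf.
have s11 : s1`_1 = r * ((tangent p v n).1 : R[i]).
  by rewrite coefZ q21 mulrCA mulKf.
have [||||r1 [r2 [E H1 H2 H3 H4]]] := IH s1 s2.
- exact: s10.
- by rewrite coefZ coefB expr2 coef0M q10 s10 -expr2 addrAC subrr add0r mulKf.
- exact: s11.
- rewrite coefZ coefB expr2 coefM big_ord_recl big_ord1 /= q11 s10 s11.
  by field.
exists r1, r2; split=> // t; rewrite -E /henonV /=; congr horbitV; congr (_, _).
  by rewrite hornerZ.
by rewrite !hornerE.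
Qed.

(** Once the orbit has norm below [1 / 4] and the coefficients are at most [1 / 4], the rows of the
    derivative sum to at most [2/4 + 1/4 = 3/4]. *)
Lemma tangent_cvg0 p v : orbit_basin a p -> (fun n => nm2 (tangent p v n)) @ \oo --> 0.
Proof.
move=> /cvg_nm2/(_ (1 / 4))[|n0 H]; first by rewrite divr_gt0.
pose n1 := maxn n0 J.
have step n : (n1 <= n)%N -> nm2 (tangent p v n.+1) <= 3 / 4 * nm2 (tangent p v n).
  move=> n1n; have /H : (n0 <= n)%N by rewrite (leq_trans _ n1n) // leq_maxl.
  rewrite subr0 => pn.
  have an : a n.+1 <= 1 / 4.
    by rewrite aJ // (leq_trans _ (leqW n1n)) // leq_maxr.
  have z4 := nm2_fst (horbit a n p).
  have w1 := nm2_fst (tangent p v n); have w2 := nm2_snd (tangent p v n).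
  have an0 := ltW (a_gt0 n.+1).
  have := nm_ge0 ((horbit a n p).1 : R[i]).
  have := nm_ge0 ((tangent p v n).1 : R[i]).
  have := nm_ge0 ((tangent p v n).2 : R[i]).
  have nm2n : nm (2%:R : R[i]) = 2 by rewrite -(rmorph_nat (real_complex R)) nmR ger0_norm.
  move=> p1 p2 p3; rewrite nm2_le; apply/andP; split.
    apply: (le_trans (nmD _ _)).
    rewrite !nmM nmR nm2n ger0_norm //.
    move: p1 p2 p3 w1 w2 z4 pn an an0.
    move: (nm _) (nm _) (nm _) (nm2 _) (nm2 _) (a _) => x y z w u b.
    by nra.
  rewrite [X in X <= _]nmM nmR ger0_norm //.
  by nra.
apply: (@geometric_cvg0 _ _ (3 / 4) n1) => // [|n]; last exact: nm2_ge0.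
by lra.
Qed.

Lemma kobayashi_basin p v : orbit_basin a p ->
  kobayashi_royden (orbit_basin a) p v = 0%E.
Proof.
move=> pb; apply/eqP; rewrite eq_le; apply/andP; split; last first.
  apply/ereal_infP => _ [r [r0 _] <-].
  by rewrite lee_fin invr_ge0 ltW.
apply/lee_addgt0Pr => e e0; rewrite add0e.
apply: ereal_inf_lbound; exists e^-1; last by rewrite invrK.
split; first by rewrite invr_gt0.
(* With [nm2 w < e / 8] and an orbit point of norm below [1 / 8], the affine disc of direction
   [e^-1 w] has max-norm below [1 / 4], hence [sqnorm] below [1 / 8], inside the ball. *)
have e8 : 0 < e / 8 by rewrite divr_gt0.
have /cvgn_dist/(_ _ e8)[n0 H0] := tangent_cvg0 v pb.
have /cvg_nm2/(_ (1 / 8))[|n1 H1] := pb; first by rewrite divr_gt0.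
pose n := maxn J (maxn n0 n1).
have Jn : (J <= n)%N by rewrite leq_maxl.
have {}H0 := H0 n (leq_trans (leq_maxl n0 n1) (leq_maxr _ _)).
have {}H1 := H1 n (leq_trans (leq_maxr n0 n1) (leq_maxr _ _)).
rewrite subr0 in H1; rewrite sub0r normrN ger0_norm ?nm2_ge0 // in H0.
pose r : R[i] := (e^-1)%:C%C.
pose w := tangent p v n; pose o := horbit a n p.
pose q1 : {poly R[i]} := (o.1 : R[i])%:P + (r * (w.1 : R[i])) *: 'X.
pose q2 : {poly R[i]} := (o.2 : R[i])%:P + (r * (w.2 : R[i])) *: 'X.
have [||||r1 [r2 [E r10 r20 r11 r21]]] := @orbitV_curve n p v r q1 q2.
- by rewrite coefD coefC coefZ coefX /= mulr0 addr0.
- by rewrite coefD coefC coefZ coefX /= mulr0 addr0.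
- by rewrite coefD coefC coefZ coefX /= add0r mulr1.
- by rewrite coefD coefC coefZ coefX /= add0r mulr1.
exists (fun t : Cx R => (r1.[t], r2.[t]) : C2 R); split.
- exact: poly_curve_holo.
- move=> z; rewrite /unit_disc /= norm_nm -[1]/((1 : R)%:C%C) ltcR => z1.
  apply: (stage_basin Jn); rewrite -E /stage /= orbitVK.
  have -> : (q1.[z], q2.[z]) = o + z *: (r *: w) :> C2 R.
    by rewrite !hornerE /=; congr (_, _); congr (_ + _); rewrite mulrC.
  rewrite (le_lt_trans (sqnorm_nm2 _)) //.
  have := nm2D o (z *: (r *: w)); rewrite !nm2Z nmR ger0_norm ?invr_ge0 ?(ltW e0) //.
  have ew : e^-1 * nm2 w < 1 / 8 by rewrite mulrC ltr_pdivrMr // mul1r mulrC.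
  have zew : nm z * (e^-1 * nm2 w) <= 1 / 8.
    rewrite (le_trans _ (ltW ew)) // ler_piMl ?(ltW z1) //.
    by rewrite mulr_ge0 ?nm2_ge0 // invr_ge0 (ltW e0).
  move=> H2; have := nm2_ge0 (o + z *: (r *: w)).
  have : nm2 (o + z *: (r *: w)) < 1 / 4 by move: H1; rewrite -/o; lra.
  by nra.
- by rewrite -!horner_coef0 in r10 r20 *; rewrite r10 r20; case: (p).
- by rewrite poly_curve_derive0 r11 r21.
Qed.

End positive_coefficients.
End henon.

(** * A plurisubharmonic function on the basin *)

Section jensen.
Context {R : realType}.
Implicit Types (q : {poly R[i]}) (x y a : R).

Lemma ln_lipschitz a x y : 0 < a -> a <= y -> 0 <= x ->
  ln (y + x) <= ln y + x / a.
Proof.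
move=> a0 ay x0; have y0 : 0 < y by apply: lt_le_trans ay.
have -> : y + x = y * (1 + x / y) by field; rewrite gt_eqF.
rewrite lnM ?posrE // ?ltr_pwDl ?divr_ge0 ?(ltW y0) // lerD2l.
rewrite (le_trans (le_ln1Dx _)) ?ltr_wpDl ?divr_ge0 ?(ltW y0) //.
  by rewrite (lt_le_trans (ltrN10 _)) // divr_ge0 // ltW.
by rewrite ler_wpM2l // lef_pV2.
Qed.

Lemma ln_prod (n : nat) (F : 'I_n -> R) : (forall j, 0 < F j) ->
  ln (\prod_(j < n) F j) = \sum_(j < n) ln (F j).
Proof.
move=> F0; suff [] : 0 < \prod_(j < n) F j /\ ln (\prod_(j < n) F j) = \sum_(j < n) ln
    (F j) by [].
elim/big_rec2: _ => [|i y1 y2 _ [p0 E]]; first by rewrite ltr01 ln1.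
by rewrite mulr_gt0 ?F0 // lnM ?posrE ?F0 // E.
Qed.

(** The rotation permutes the factors cyclically. *)
Lemma jensen_shift q N (z : R[i]) (P := fun z : R[i] => \prod_(j < N) nm q.[croot N ^+
    j * z]) :
  P (croot N * z) = P z.
Proof.
case: N @P => [|N] P; first by rewrite /P !big_ord0.
rewrite /P big_ord_recr [RHS]big_ord_recl /= mulrC; congr (_ * _).
  by rewrite mulrA -exprSr crootX expr0.
by apply: eq_bigr => j _; rewrite /bump /= add1n mulrA -exprSr.
Qed.

(* Apply the maximum principle to the product of the rotated copies
   [q (w ^ j * z)], [w] a primitive [N]-th root of unity, whose value at [0]
   is [q(0) ^ N]; this avoids any discussion of the zeros of [q]. *)
Lemma jensen_discrete q N : (0 < N)%N -> exists2 al : R,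
  0 <= al <= pi *+ 2 / N%:R &
  nm q.[0] ^+ N <= \prod_(j < N) nm q.[cis (al + (pi *+ 2 / N%:R) *+ j)].
Proof.
move=> N0; pose w : R[i] := croot N.
pose G := \prod_(j < N) (q \Po (w ^+ j *: 'X)).
have GE z : nm G.[z] = \prod_(j < N) nm q.[w ^+ j * z].
  rewrite horner_prod nm_prod; apply: eq_bigr => j _.
  by rewrite horner_comp !hornerE.
(* [K] exceeds the size of [G], so the maximum over the [K]-th roots of unity bounds [G(0)]; as a
   multiple of [N], it refines the [N]-th roots, with [w' ^ M = w]. *)
pose M := (size G).+1; pose K := (M * N)%N; pose w' : R[i] := croot K.
have K0 : (0 < K)%N by rewrite muln_gt0.
have KR : (K%:R : R) != 0 by rewrite pnatr_eq0 -lt0n.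
have NR : (N%:R : R) != 0 by rewrite pnatr_eq0 -lt0n.
have w'M : w' ^+ M = w.
  rewrite /w' /croot -cisMn -[_ *+ M]mulr_natr; congr cis.
  by rewrite /K natrM; field; rewrite NR pnatr_eq0.
have [k kK Gk] : exists2 k, (k < K)%N & nm q.[0] ^+ N <= nm G.[w' ^+ k].
  have : nm G`_0 * 1 ^+ 0 <= \big[Order.max/0]_(k < K) nm G.[w' ^+ k].
    apply: (@coef_bound_roots R G K) => //.
      by rewrite (leq_trans (leqnSn _)) // leq_pmulr.
    move=> j jK; rewrite mul1r.
    exact: (le_bigmax (0 : R) (fun i : 'I_K => nm G.[w' ^+ i]) (Ordinal jK)).
  rewrite expr0 mulr1 -horner_coef0 GE.
  under eq_bigr do rewrite mulr0.
  rewrite prodr_const card_ord => H.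
  have [k _ Hk] := @eq_bigmax _ _ _ 0 (Ordinal K0) xpredT (fun i : 'I_K => nm G.[w' ^+
      i]) isT (fun i _ => nm_ge0 _).
  by exists k => //; rewrite -Hk.
(* Invariance under rotation by [w] brings the maximising angle into the first of the [N] arcs. *)
have Gshift m r : nm G.[w' ^+ (m * M + r)] = nm G.[w' ^+ r].
  elim: m => [|m IH] //; rewrite mulSn -addnA exprD w'M GE jensen_shift -GE.
  exact: IH.
pose r := (k %% M)%N.
have rM : (r < M)%N by rewrite ltn_mod.
exists ((pi *+ 2 / K%:R) *+ r).
  have p0 : 0 < (pi : R) *+ 2 / K%:R by apply: divr_gt0; [rewrite mulrn_wgt0
      ?pi_gt0|rewrite ltr0n].
  rewrite mulrn_wge0 ?(ltW p0) //=.
  rewrite (_ : pi *+ 2 / N%:R = (pi *+ 2 / K%:R) *+ M).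
    by rewrite (ler_wpMn2l (ltW p0) (ltnW rM)).
  by rewrite -[_ *+ M]mulr_natr /K natrM; field; rewrite NR pnatr_eq0.
rewrite (le_trans Gk) // (divn_eq k M) Gshift GE le_eqVlt; apply/orP; left.
apply/eqP; apply: eq_bigr => j _; congr (nm _.[_]).
by rewrite cisD !cisMn mulrC.
Qed.

Lemma cis_ucont e : 0 < e -> exists2 d : R, 0 < d &
  forall x y, `|x - y| < d -> nm (cis x - cis y) < e.
Proof.
move=> e0; have e2 : 0 < e / 2 by rewrite divr_gt0.
have /cvgrPdist_lt/(_ _ e2)/nbhs_ballP[d1 d10 H1] := @continuous_cos R 0.
have /cvgrPdist_lt/(_ _ e2)/nbhs_ballP[d2 d20 H2] := @continuous_sin R 0.
exists (Order.min d1 d2); first by rewrite lt_min; apply/andP.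
move=> x y; rewrite lt_min => /andP[xy1 xy2].
rewrite [X in nm X](_ : _ = cis y * (cis (x - y) - 1)); last first.
  by rewrite mulrBr mulr1 -cisD addrCA subrr addr0.
rewrite nmM nm_cis mul1r (le_lt_trans (nm_le_ReIm _)) //= [e]splitr ltrD //.
  have := H1 (x - y); rewrite -ball_normE /= sub0r normrN cos0 [X in _ -> X < _]distrC;
      apply; exact: xy1.
have := H2 (x - y); rewrite -ball_normE /= sub0r normrN sin0 [X in _ -> X < _]distrC;
    apply; exact: xy2.
Qed.

Lemma poly_lipschitz q : exists2 C, 0 <= C & forall z w : R[i],
  nm z <= 1 -> nm w <= 1 -> nm (q.[z] - q.[w]) <= C * nm (z - w).
Proof.
elim/poly_ind: q => [|q c [C C0 HC]].
  by exists 0 => // z w _ _; rewrite !horner0 subrr nm0 mul0r.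
have [M HM] := poly_unit_disc_bounded q.
exists (Order.max 0 M + C); first by rewrite addr_ge0 // le_max lexx.
move=> z w z1 w1; rewrite !hornerE.
have -> : q.[z] * z + c - (q.[w] * w + c) = q.[z] * (z - w) + (q.[z] - q.[w]) * w by ring.
rewrite (le_trans (nmD _ _)) // !nmM mulrDl lerD //.
  by rewrite ler_wpM2r ?nm_ge0 // (le_trans (HM _ z1)) // le_max lexx orbT.
rewrite (le_trans (ler_piMr _ w1)) ?nm_ge0 //; exact: HC.
Qed.

(** The floor [a] removes the singularities of [ln] at the zeros of [q]: the function becomes
    uniformly continuous and Riemann sums suffice. *)
Definition log_max q a x := ln (Order.max (nm q.[cis x]) a).

Lemma log_max_ucont q a e : 0 < a -> 0 < e -> exists2 d : R, 0 < d &
  forall x y, `|x - y| < d -> log_max q a x <= log_max q a y + e.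
Proof.
move=> a0 e0; have [C C0 HC] := poly_lipschitz q.
have C1 : 0 < C + 1 by rewrite ltr_wpDl.
have [|d d0 Hd] := @cis_ucont (e * a / (C + 1)).
  by rewrite divr_gt0 // mulr_gt0.
exists d => // x y /Hd; rewrite ltr_pdivlMr // => xy.
have qxy : nm (q.[cis x] - q.[cis y]) <= e * a.
  rewrite (le_trans (HC _ _ _ _)) ?nm_cis // (le_trans _ (ltW xy)) //.
  by rewrite mulrC ler_wpM2l ?nm_ge0 // lerDl.
have my : a <= Order.max (nm q.[cis y]) a by rewrite le_max lexx orbT.
have m0 : 0 < Order.max (nm q.[cis y]) a by apply: lt_le_trans my.
have ea : 0 <= e * a by rewrite mulr_ge0 // ltW.
apply: (@le_trans _ _ (ln (Order.max (nm q.[cis y]) a + e * a))).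
  rewrite ler_ln ?posrE ?ltr_pwDl // ?lt_max ?a0 ?orbT //.
  rewrite ge_max; apply/andP; split; last by rewrite (le_trans my) // lerDl.
  rewrite -(subrK (q.[cis y]) (q.[cis x])) (le_trans (nmD _ _)) // addrC.
  by rewrite lerD // le_max lexx.
by rewrite (le_trans (ln_lipschitz a0 my ea)) // mulfK // gt_eqF.
Qed.

Lemma log_max_continuous q a : 0 < a -> continuous (log_max q a).
Proof.
move=> a0 x; apply/cvgrPdist_le => e e0; have [d d0 Hd] := log_max_ucont q a0 e0.
apply: filterS (nbhsx_ballx x _ d0) => y; rewrite -ball_normE /= => xy.
rewrite ler_norml; apply/andP; split.
  by rewrite lerBrDr addrC lerBlDr Hd // distrC.
by rewrite lerBlDr addrC Hd.
Qed.

(** The submean inequality for a tagged Riemann sum: [al] is not controlled, but it is at most one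
    mesh, so each sample lies in its own subinterval. *)
Lemma log_max_sum q a N : 0 < a -> (0 < N)%N -> exists2 al : R,
  0 <= al <= pi *+ 2 / N%:R &
  ln (Order.max (nm q.[0]) a) *+ N <=
    \sum_(j < N) log_max q a (al + (pi *+ 2 / N%:R) *+ j).
Proof.
move=> a0 N0; have [al alN H] := jensen_discrete q N0; exists al => //.
have mx (x : R) : 0 < Order.max x a by rewrite lt_max a0 orbT.
rewrite -ln_prod // -lnXn // ler_ln ?posrE ?exprn_gt0 ?prodr_gt0 //.
set m := Order.max (nm q.[0]) a.
have [-> | ->] : m = nm q.[0] \/ m = a.
  by rewrite /m /Order.max; case: ifP; [right|left].
  rewrite (le_trans H) // ler_prod // => j _.
  by rewrite nm_ge0 le_max lexx.
rewrite -[X in a ^+ X]card_ord -prodr_const ler_prod // => j _.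
by rewrite ltW //= le_max lexx orbT.
Qed.

Lemma integral_partition_le (k : R -> R) (h : R) (c : nat -> R) n :
  0 < h -> continuous k -> (forall x, 0 <= x <= h *+ n -> 0 <= k x) ->
  (forall j x, (j < n)%N -> h *+ j <= x -> x <= h *+ j.+1 -> k x <= c j) ->
  (\int[lebesgue_measure]_(x in `[0%R, (h *+ n)%R[) (k x)%:E <=
    (h * \sum_(j < n) c j)%:E)%E.
Proof.
move=> h0 kc; elim: n => [|n IH] k0 kcj.
  by rewrite mulr0n big_ord0 mulr0 set_itv_ge ?integral_set0 // bnd_simp ltxx.
have km (D : set (measurableTypeR R)) : measurable D -> measurable_fun D (EFin \o k).
  move=> mD; apply/measurable_EFinP; apply: measurable_funTS.
  exact: continuous_measurable_fun.
have hn : 0 <= h *+ n by rewrite mulrn_wge0 // ltW.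
have hnS : h *+ n <= h *+ n.+1 by rewrite ler_wpMn2l // ltW.
rewrite (@itv_bndbnd_setU _ _ (BLeft 0) (BLeft (h *+ n))) ?bnd_simp //.
rewrite ge0_integral_setU //=; last 3 first.
- by apply: km; apply: measurableU.
- move=> x [] /=; rewrite in_itv /= lee_fin => /andP[x1 x2]; rewrite k0 //.
    by rewrite x1 (le_trans (ltW x2)).
  by rewrite (le_trans hn x1) ltW.
- apply/disj_setPS => x /= []; rewrite !in_itv /= => /andP[_ xn] /andP[nx _].
  by have := lt_le_trans xn nx; rewrite ltxx.
rewrite big_ord_recr /= mulrDr EFinD leeD //.
  apply: IH => [x /andP[x1 x2]|j x jn]; last by apply: kcj; rewrite (leq_trans jn).
  by rewrite k0 // x1 (le_trans x2).
apply: (@le_trans _ _ (\int[lebesgue_measure]_(x in `[(h *+ n)%R, (h *+ n.+1)%R[) (cst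
    (c n)%:E) x)%E).
  apply: ge0_le_integral => //.
  - move=> x /=; rewrite in_itv /= lee_fin => /andP[x1 x2].
    by rewrite k0 // (le_trans hn x1) ltW.
  - exact: km.
  - by move=> x /=; rewrite in_itv /= => /andP[nx xn]; rewrite lee_fin kcj // ltW.
rewrite integral_cst //= lebesgue_measure_itv /= lte_fin ltr_pMn2l //.
rewrite ltnSn -EFinB -EFinM lee_fin mulrS addrK mulrC //.
Qed.

(** The integrand is nonnegative, as monotone convergence will require; with [B = - ln 2] and
    [s = 2^-m] it is minus the height at a stage. *)
Lemma log_max_submean q a (s B : R) : 0 < a -> 0 <= s ->
  (forall x, 0 <= x <= pi *+ 2 -> log_max q a x <= B) ->
  (\int[lebesgue_measure]_(x in `[0%R, ((pi : R) *+ 2)%R])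
      (s * (B - log_max q a x))%:E <=
    (pi *+ 2 * (s * (B - ln (Order.max (nm q.[0]) a))))%:E)%E.
Proof.
move=> a0 s0 HB; set l0 := ln _.
have kc : continuous (fun x => s * (B - log_max q a x)).
  move=> x; apply: cvgM; first exact: cvg_cst.
  by apply: cvgB; [exact: cvg_cst|exact: log_max_continuous].
have p0 : 0 < (pi : R) *+ 2 by rewrite mulrn_wgt0 ?pi_gt0.
apply/lee_addgt0Pr => e e0.
(* The oscillation over one mesh, integrated over length [2 pi] with weight [s], then costs at most
   [e]; [s + 1] covers [s = 0]. *)
have e1 : 0 < e / (pi *+ 2 * (s + 1)) by rewrite divr_gt0 // mulr_gt0 // ltr_wpDl.
have [d d0 Hd] := log_max_ucont q a0 e1.
set e' := e / _ in e1 Hd.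
have [N Ngt0 hd] : exists2 N, (0 < N)%N & pi *+ 2 / N%:R < d.
  exists (Num.truncn (pi *+ 2 / d)).+1 => //.
  by rewrite ltr_pdivrMr ?ltr0n // mulrC -ltr_pdivrMr // truncnS_gt.
have N0 : 0 < (N%:R : R) by rewrite ltr0n.
pose h : R := pi *+ 2 / N%:R.
have h0 : 0 < h by rewrite divr_gt0.
have hN : h *+ N = pi *+ 2 by rewrite -[_ *+ N]mulr_natr divfK // gt_eqF.
have [al /andP[al0 alh] Hal] := @log_max_sum q a N a0 Ngt0.
rewrite -/h in alh Hal.
rewrite -integral_itv_bndo_bndc; last first.
  apply/measurable_EFinP; apply: measurable_funTS.
  exact: continuous_measurable_fun.
rewrite -{1}hN.
apply: (le_trans (@integral_partition_le _ h
   (fun j => s * (B - log_max q a (al + h *+ j) + e')) N h0 kc _ _)).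
- by move=> x; rewrite hN => x2; rewrite mulr_ge0 // subr_ge0 HB.
- move=> j x jN jx xj; rewrite ler_wpM2l // -addrA lerD2l.
  rewrite -[leRHS]opprK lerN2 opprD opprK lerBlDr; apply: Hd.
  rewrite (le_lt_trans _ hd) // -/h ler_norml.
  move: xj; rewrite mulrS => xj.
  by apply/andP; split; lra.
rewrite -EFinD lee_fin -mulr_sumr big_split /= sumrB !sumr_const card_ord.
move: Hal; rewrite -/l0; set S := \sum_(j < N) _ => Hal.
have E (x y z w n t : R) : x * (y * (z * n - w + t * n)) =
    x * n * (y * z) + x * n * (y * t) - x * (y * w) by ring.
rewrite -[B *+ N]mulr_natr -[e' *+ N]mulr_natr E mulr_natr.
have hs : h *+ N * (s * l0) <= h * (s * S).
  rewrite (_ : h *+ N * (s * l0) = h * (s * (l0 *+ N))); last first.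
    by rewrite -[h *+ N]mulr_natr -[l0 *+ N]mulr_natr mulrACA -!mulrA; congr (_ * _);
        rewrite mulrCA [_ * l0]mulrC mulrCA.
  by rewrite !ler_wpM2l // ltW.
have ee : h *+ N * (s * e') <= e.
  rewrite hN (_ : pi *+ 2 * (s * e') = e * (s / (s + 1))).
    by rewrite ler_piMr ?(ltW e0) // ler_pdivrMr ?ltr_wpDl // mul1r lerDl.
  have s1 : s + 1 != 0 by rewrite gt_eqF // ltr_wpDl.
  have F (x y z : R) : x != 0 -> z != 0 -> x * (y * (e / (x * z))) = e * (y / z).
    by move=> x0 z0; field; rewrite ?x0 ?z0.
  by rewrite /e' F // gt_eqF.
rewrite mulrBr mulrBr -hN; lra.
Qed.
End jensen.

(** * The limit of the heights over the stages *)

Section plurisubharmonic_limit.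
Context {R : realType}.
Variables (a : nat -> R) (J : nat).
Hypothesis a_gt0 : forall n, 0 < a n.
Hypothesis aJ : forall n, (J <= n)%N -> a n <= 1 / 4.
Hypothesis a_sqr : forall n, (J <= n)%N -> a n.+1 <= a n ^+ 2.
Hypothesis a_super : forall K : R, exists2 n, (J <= n)%N & ln (2 * a n) / 2 ^+ n < K.
Implicit Types (p v : C2 R).

(** A variant of [2^-n log |z_n|], whose limit is the Green function in autonomous dynamics. The
    floor [a n] keeps it finite and continuous at zeros of [z_n]; the factor 2 makes the sequence
    decrease. *)
Definition log_height n p : R :=
  ln (2 * Order.max (nm ((horbit a n p).1 : R[i])) (a n)) / 2 ^+ n.

Let mx n p := Order.max (nm ((horbit a n p).1 : R[i])) (a n).

Let mx_gt0 n p : 0 < mx n p.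
Proof. by rewrite lt_max a_gt0 orbT. Qed.

Let exp2_gt0 n : 0 < (2 : R) ^+ n.
Proof. by rewrite exprn_gt0. Qed.

Lemma stage_nm n p : stage a n p ->
  nm ((horbit a n p).1 : R[i]) < 1 / 2 /\ nm ((horbit a n p).2 : R[i]) < 1 / 2.
Proof.
rewrite /stage /= /sqnorm; have := nm_ge0 ((horbit a n p).1 : R[i]).
have := nm_ge0 ((horbit a n p).2 : R[i]); move: (nm _) (nm _) => x y x0 y0 xy.
by split; nra.
Qed.

Lemma log_height_le0 n p : (J <= n)%N -> stage a n p -> log_height n p <= 0.
Proof.
move=> Jn /stage_nm[z2 _]; rewrite /log_height -/(mx n p) pmulr_lle0 ?invr_gt0 //.
rewrite -ln1 ler_ln ?posrE ?mulr_gt0 // mulrC -ler_pdivlMr // /mx ge_max.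
rewrite (ltW z2) (le_trans (aJ Jn)) //; lra.
Qed.

(** With [m = max(|z|, a_n)] and [|w| < 1/2], the next first coordinate is at most
    [m^2 + a_n^2 / 2 <= 2 m^2]; the factor 2 in the height turns this into [2 m' <= (2 m)^2]. *)
Lemma log_height_decreasing n p : (J <= n)%N -> stage a n p ->
  log_height n.+1 p <= log_height n p.
Proof.
move=> Jn pn; have [_ w2] := stage_nm pn.
rewrite /log_height -!/(mx _ _) exprS ler_pdivrMr ?mulr_gt0 //.
rewrite (_ : _ * (2 * _) = ln (2 * mx n p) *+ 2); last first.
  by rewrite -mulr_natr; field; rewrite gt_eqF.
rewrite -lnXn ?mulr_gt0 // ler_ln ?posrE ?mulr_gt0 ?exprn_gt0 ?mulr_gt0 //.
have m0 := mx_gt0 n p.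
have a2 := a_sqr Jn; have a0 := a_gt0 n; have a0' := a_gt0 n.+1.
have am : a n <= mx n p by rewrite le_max lexx orbT.
have zm : nm ((horbit a n p).1 : R[i]) <= mx n p by rewrite le_max lexx.
have am2 : a n ^+ 2 <= mx n p ^+ 2 by nra.
rewrite exprMn [2 ^+ 2]expr2 -mulrA ler_pM2l // {1}/mx ge_max; apply/andP; split; last
    first.
  by apply: (le_trans a2); lra.
apply: (le_trans (nmD _ _)); rewrite nmX nmM nmR gtr0_norm //.
have := nm_ge0 ((horbit a n p).1 : R[i]); have := nm_ge0 ((horbit a n p).2 : R[i]).
move: zm w2; move: (nm _) (nm _) => z w zm w2 z0 w0.
nra.
Qed.

(** Outside the stage the value is [0], an upper bound for the heights inside; as the stages grow,
    the sequence is then nonincreasing at every point of [C2 R]. *)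
Definition green_stage n p : \bar R :=
  (if `[< stage a (J + n) p >] then log_height (J + n) p else 0)%:E.

Definition green p : \bar R := ereal_inf (range (green_stage^~ p)).

Lemma green_stageE n p : stage a (J + n) p ->
  green_stage n p = (log_height (J + n) p)%:E.
Proof. by rewrite /green_stage => H; case: asboolP. Qed.

Lemma green_stage_le0 n p : (green_stage n p <= 0)%E.
Proof.
rewrite /green_stage lee_fin; case: asboolP => // H.
by apply: log_height_le0; rewrite ?leq_addr.
Qed.

Lemma green_stage_nonincreasing p : nonincreasing_seq (green_stage^~ p).
Proof.
apply/nonincreasing_seqP => n; rewrite /green_stage lee_fin.
case: asboolP => [H1|H1]; case: asboolP => [H2|H2] //.
- by rewrite addnS log_height_decreasing // leq_addr.
- by rewrite log_height_le0 // leq_addr.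
- case: H1; rewrite addnS; apply: (stage_subset a_gt0 aJ _ _ H2) => //.
  exact: leq_addr.
Qed.

Lemma green_le n p : (green p <= green_stage n p)%E.
Proof. by apply: ereal_inf_lbound; exists n. Qed.

Lemma green_le0 p : (green p <= 0)%E.
Proof. exact: le_trans (green_le 0 p) (green_stage_le0 _ _). Qed.

Lemma green_cvg p : green_stage^~ p @ \oo --> green p.
Proof. exact: ereal_nonincreasing_cvgn (green_stage_nonincreasing p). Qed.

(** Some stage value at [p] is already below [b]. If [p] lies in that open stage, continuity of the
    height there applies; otherwise the value is [0], and [green <= 0 < b] everywhere. *)
Lemma green_upper_semicontinuous p (b : R) : (green p < b%:E)%E ->
  \forall q \near p, (green q < b%:E)%E.
Proof.
move=> /ereal_inf_lt[_ [n _ <-]]; rewrite /green_stage lte_fin.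
case: asboolP => [pn|_ b0]; last first.
  by apply: filterE => q; rewrite (le_lt_trans (green_le0 q)).
rewrite /log_height -/(mx _ _) ltr_pdivrMr // -{1}[b * _]expRK ltr_ln ?posrE ?mulr_gt0
    ?expR_gt0 //.
rewrite mulrC -ltr_pdivlMr // /mx gt_max => /andP[zb ab].
have e0 : 0 < expR (b * 2 ^+ (J + n)) / 2 - nm ((horbit a (J + n) p).1 : R[i]).
  by rewrite subr_gt0.
have [d d0 Hd] := (continuous_nm2 _ _).1 (@orbit_continuous R a (J + n) p) _ e0.
have near_d : \forall q \near p, nm2 (q - p) < d by apply/nbhs_nm2; exists d.
have near_s : \forall q \near p, stage a (J + n) q.
  by apply: open_nbhs_nbhs; split; [exact: open_stage|].
apply: filterS2 near_d near_s => q /Hd qd qn.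
rewrite (le_lt_trans (green_le n q)) // green_stageE // lte_fin.
rewrite /log_height -/(mx _ _) ltr_pdivrMr // -{1}[b * _]expRK ltr_ln ?posrE ?mulr_gt0
    ?expR_gt0 //.
rewrite mulrC -ltr_pdivlMr // /mx gt_max ab andbT.
rewrite -(subrK ((horbit a (J + n) p).1 : R[i]) ((horbit a (J + n) q).1 : R[i])).
rewrite (le_lt_trans (nmD _ _)) // -ltrBrDr (le_lt_trans _ qd) //.
exact: (nm2_fst (horbit a (J + n) q - horbit a (J + n) p)).
Qed.

Lemma circle_continuous p v : continuous (fun th : R => p + (cis th : R[i]) *: v : C2 R).
Proof.
move=> th A /nbhs_nm2[e e0 eA].
have V0 : 0 < nm2 v + 1 by rewrite ltr_wpDl // nm2_ge0.
have [d d0 Hd] := cis_ucont (divr_gt0 e0 V0).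
apply: filterS (nbhsx_ballx th _ d0) => s.
rewrite -ball_normE /= distrC => /Hd; rewrite ltr_pdivlMr // => st; apply: eA.
rewrite opprD addrACA subrr add0r -scalerBl nm2Z (le_lt_trans _ st) //.
by rewrite ler_wpM2l ?nm_ge0 // lerDl.
Qed.

(** The stages are open and increasing and the circle is compact, so one index serves all its
    points. *)
Lemma circle_in_stage p v :
  (forall zeta : R[i], `|zeta| <= 1 -> orbit_basin a (p + zeta *: v)) ->
  exists n0, forall n, (n0 <= n)%N ->
    stage a (J + n) p /\ forall th, 0 <= th <= pi *+ 2 -> stage a (J + n) (p + (cis th
        : R[i]) *: v).
Proof.
move=> disc; pose C := [set (p + (cis th : R[i]) *: v : C2 R) | th in (`[0, pi *+
    2]%classic : set R)].
have Cc : compact C.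
  apply: continuous_compact; last exact: segment_compact.
  by apply: continuous_subspaceT => th; exact: circle_continuous.
have /compact_near_coveringP/(_ nat \oo (fun n q => stage a (J + n) q) _) := Cc.
have near_stage q : orbit_basin a q -> exists n0, forall n, (n0 <= n)%N -> stage a (J +
    n) q.
  move=> /basin_stage[n0 H]; exists n0 => n nn; apply: H.
  by rewrite (leq_trans nn) // leq_addl.
case.
  move=> _ [th _ <-].
  have [|n0 Hn0] := @near_stage (p + (cis th : R[i]) *: v).
    apply: disc; rewrite norm_nm nm_cis //.
  have /open_nbhs_nbhs H : open_nbhs (p + (cis th : R[i]) *: v) (stage a (J + n0)).
    by split; [exact: open_stage|exact: Hn0].
  exists (stage a (J + n0), [set n | (n0 <= n)%N]) => /=.
    by split => //; exists n0.
  move=> [q n] /= [qn nn]; apply: (stage_subset a_gt0 aJ _ _ qn).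
    by rewrite leq_addr.
  by rewrite leq_add2l.
move=> n1 _ Hn1; have [|n0 Hn0] := @near_stage p.
  by rewrite -[p]addr0 -(scale0r v); apply: disc; rewrite normr0.
exists (maxn n0 n1) => n; rewrite geq_max => /andP[nn0 nn1]; split; first exact: Hn0.
move=> th th2; by apply: (Hn1 n nn1); exists th.
Qed.

(** On a complex line the heights come from polynomials, so each stage satisfies the inequality.
    Minus the stage values are nonnegative and increase, and monotone convergence passes to the
    limit even where [green] is [-oo]. *)
Lemma green_submean p v :
  (forall zeta : R[i], `|zeta| <= 1 -> orbit_basin a (p + zeta *: v)) ->
  (green p <= (((pi : R) *+ 2)^-1)%R%:E *
     \int[lebesgue_measure]_(th in `[0%R, ((pi : R) *+ 2)%R])
       green ((p + ((cos th) +i* (sin th) : R[i])%C *: v)%R))%E.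
Proof.
move=> disc; have [n0 Hn0] := circle_in_stage disc.
have p0 : 0 < (pi : R) *+ 2 by rewrite mulrn_wgt0 ?pi_gt0.
pose D : set R := `[0%R, ((pi : R) *+ 2)%R]%classic.
pose c th : C2 R := p + (cis th : R[i]) *: v.
pose m n := (J + (n + n0))%N.
have stage_c n th : D th -> stage a (m n) (c th).
  rewrite /D /= in_itv /= => th2; apply: (Hn0 (n + n0)%N _).2 => //.
  by rewrite leq_addl.
have [q qE] : exists q : nat -> {poly R[i]}, forall n t, (horbit a n (p + t *: v)).1 =
    (q n).[t].
  have H n : exists qn : {poly R[i]}, forall t, (horbit a n (p + t *: v)).1 = qn.[t].
    have [A [B /(_ v)[qn H _]]] := polyfun_linear_part p (polymap_orbit a n polymap_id).1.
    by exists qn.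
  by exists (fun n => projT1 (cid (H n))) => n; case: (cid (H n)).
(* Written through the polynomial, [k n] is continuous on all of [R]; its agreement with minus
   [green_stage] is needed only on [D]. *)
pose k n (th : R) := (2 ^+ m n)^-1 * (- ln 2 - log_max (q (m n)) (a (m n)) th).
have lhE n t : - log_height (m n) (p + t *: v) =
    (2 ^+ m n)^-1 * (- ln 2 - ln (Order.max (nm (q (m n)).[t]) (a (m n)))).
  rewrite /log_height -/(mx _ _) lnM ?posrE // /mx qE.
  by rewrite mulrC -mulrN opprD.
have kE n th : D th -> (k n th)%:E = (- green_stage (n + n0) (c th))%E.
  by move=> Dth; rewrite (green_stageE (stage_c n th Dth)) -EFinN lhE.
have k0 n th : D th -> (0 <= (k n th)%:E)%E.
  by move=> Dth; rewrite kE // oppe_ge0 green_stage_le0.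
have kc n : continuous (k n).
  move=> x; apply: cvgM; first exact: cvg_cst.
  by apply: cvgB; [exact: cvg_cst|apply: log_max_continuous].
have kle n : (\int[lebesgue_measure]_(th in D) (k n th)%:E <= (pi *+ 2)%:E * - green p)%E.
  apply: (le_trans (log_max_submean (a_gt0 (m n)) _ _)).
  - by rewrite invr_ge0 ltW.
  - move=> x x2; have : 0 <= k n x.
      by rewrite -lee_fin k0 // /D /= in_itv.
    by rewrite /k pmulr_rge0 ?invr_gt0 // subr_ge0.
  rewrite -lhE scale0r addr0 EFinM EFinN lee_pmul2l ?lte_fin //.
  rewrite leeN2 (le_trans (green_le (n + n0) p)) // green_stageE //.
  by apply: (Hn0 (n + n0)%N _).1; rewrite leq_addl.
have mD : measurable D by exact: measurable_itv.
have kmeas n : measurable_fun D (fun th => (k n th)%:E).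
  apply/measurable_EFinP; apply: measurable_funTS.
  exact: continuous_measurable_fun.
have kmono th : D th -> {homo (fun n => (k n th)%:E) : i j / (i <= j)%N >-> (i <= j)%E}.
  move=> Dth i j ij; rewrite !kE // leeN2.
  by apply: green_stage_nonincreasing; rewrite leq_add2r.
have klim th : D th -> limn (fun n => (k n th)%:E) = (- green (c th))%E.
  move=> Dth; apply: cvg_lim => //.
  rewrite (_ : (fun n => _) = (fun n => - green_stage (n + n0) (c th))%E); last first.
    by apply/funext => n; rewrite kE.
  apply: cvgeN; rewrite (cvg_shiftn n0 (green_stage^~ (c th))).
  exact: green_cvg.
have I_le : (\int[lebesgue_measure]_(th in D) - green (c th) <= (pi *+ 2)%:E * - green p)%E.
  rewrite (_ : integral _ _ _ = \int[lebesgue_measure]_(th in D) limn (fun n => (k n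
      th)%:E))%E; last first.
    by apply: eq_integral => th; rewrite inE => /klim.
  have cv := cvg_monotone_convergence (mu := lebesgue_measure) mD kmeas k0 kmono.
  rewrite -(cvg_lim (@ereal_hausdorff R) cv).
  apply: lime_le; first by apply/cvg_ex; eexists; exact: cv.
  by apply: nearW => n; exact: kle.
rewrite (_ : integral _ _ _ = \int[lebesgue_measure]_(th in D) - (- green (c th)))%E;
    last first.
  by apply: eq_integral => th _; rewrite oppeK.
rewrite integral_ge0N; last by move=> th _; rewrite oppe_ge0 green_le0.
by rewrite muleN leeNr lee_pdivrMl.
Qed.

Lemma green_psh : plurisubharmonic (orbit_basin a) green.
Proof.
split=> [p _|p _ b|p v]; last exact: green_submean.
  by rewrite lt_eqF // (le_lt_trans (green_le0 p)) // ltry.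
exact: green_upper_semicontinuous.
Qed.

Lemma green_origin : green (0 : C2 R) = -oo%E.
Proof.
have H (K : R) : (green (0%R : C2 R) <= K%:E)%E.
  have [n Jn nK] := a_super K.
  rewrite (le_trans (green_le (n - J) (0 : C2 R))) // green_stageE subnKC //; last
      exact: stage_origin.
  rewrite lee_fin (le_trans _ (ltW nK)) // /log_height orbit0.
  by rewrite (nm0 : nm ((0 : C2 R).1 : R[i]) = 0) max_r // ltW.
case: (green (0 : C2 R)) H => [r| |] H //; last by have := H 0.
by have := H (r - 1); rewrite lee_fin lerBrDr gerDl ler10.
Qed.

(** The coefficients are positive, so nothing cancels on the nonnegative real axis and squaring
    alone gives the lower bound. It also exhibits a point outside the basin in (B). *)
Lemma orbit_real (x : R) n : 0 <= x -> exists y w : R,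
  [/\ horbit a n (x%:C%C, 0) = (y%:C%C, w%:C%C), x ^+ (2 ^ n) <= y & 0 <= w].
Proof.
move=> x0; elim: n => [|n [y [w [E xy w0]]]].
  by exists x, 0; rewrite expn0 expr1.
have y0 : 0 <= y by rewrite (le_trans _ xy) // exprn_ge0.
exists (y ^+ 2 + a n.+1 * w), (a n.+1 * y); split.
- by rewrite /= E /henon rmorphD rmorphXn !rmorphM.
- rewrite expnSr exprM (le_trans _ (_ : y ^+ 2 <= _)) //.
    by rewrite lerXn2r // nnegrE exprn_ge0.
  by rewrite lerDl mulr_ge0 // ltW.
- by rewrite mulr_ge0 // ltW.
Qed.

(** The minimum with [0] accounts for stages that miss the point, where the value is [0]. *)
Lemma green_real_axis (x : R) : 0 < x -> ((Order.min (ln x) 0)%:E <= green (x%:C%C, 0%R))%E.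
Proof.
move=> x0; apply: le_ereal_inf_tmp => _ [n _ <-]; rewrite /green_stage lee_fin.
case: asboolP => _; last by rewrite ge_min lexx orbT.
rewrite ge_min; apply/orP; left; have [y [w [E xy w0]]] := orbit_real (J + n) (ltW x0).
rewrite /log_height -/(mx _ _) ler_pdivlMr //.
rewrite -natrX mulr_natr -lnXn // ler_ln ?posrE ?mulr_gt0 ?exprn_gt0 //.
have y0 : 0 <= y by rewrite (le_trans _ xy) // exprn_ge0 // ltW.
have ym : y <= mx (J + n) (x%:C%C, 0).
  by rewrite /mx E le_max [X in _ <= X]nmR ger0_norm // lexx.
by apply: (le_trans xy); lra.
Qed.

Lemma short_basin : short_C2 (orbit_basin a).
Proof.
split.
- exact: (basin_domain a_gt0 aJ).
- exists (fun j => stage a (J + j)); split.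
  + move=> j; split; first exact: stage_domain.
    have [f [g [hf hg fg gf]]] := stage_biholomorphic a_gt0 (J + j).
    by exists f, g.
  + move=> j p; apply: (stage_subset a_gt0 aJ); first exact: leq_addr.
    by rewrite leq_add2l.
  + exact: basin_bigcup.
- by move=> p v; exact: (kobayashi_basin a_gt0 aJ).
exists green; split; first exact: green_psh.
  by exists 0 => p _; exact: green_le0.
have : nbhs (0 : C2 R) (stage a J).
  by apply: open_nbhs_nbhs; split; [exact: open_stage|exact: stage_origin].
move=> /nbhs_nm2[e e0 He]; pose x := e / 2.
have x0 : 0 < x by rewrite divr_gt0.
have xJ : stage a J (x%:C%C, 0).
  apply: He; rewrite subr0 nm2_lt; apply/andP; split.
    rewrite -[X in X < _]/(nm (x%:C%C : R[i])) nmR gtr0_norm // /x; lra.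
  by rewrite -[X in X < _]/(nm (0 : R[i])) nm0.
exists 0, (x%:C%C, 0); split.
- exact: (stage_basin a_gt0 aJ (leqnn J) (stage_origin _ _)).
- exact: (stage_basin a_gt0 aJ (leqnn J) xJ).
rewrite green_origin eq_sym; apply: contraTneq (green_real_axis x0) => ->.
by rewrite leeNy_eq.
Qed.

End plurisubharmonic_limit.

(** * Straightening the basin by shears *)

Section limits.
Context {R : realType}.

(** Biholomorphisms are encoded by functions on all of [C2 R], so the limit must be total; the
    default is [0]. *)
Definition C2_limit (u : nat -> C2 R) : C2 R :=
  xget (0 : C2 R) [set l : C2 R | u @ \oo --> l].

Lemma C2_limit_cauchy (u : nat -> C2 R) (m : nat) (s : nat -> R) :
  (forall n k, (m <= n)%N -> (n <= k)%N -> nm2 (u k - u n) <= s n) ->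
  s @ \oo --> 0 -> forall n, (m <= n)%N -> nm2 (u n - C2_limit u) <= s n.
Proof.
move=> us s0.
have [||l Hl] := @C2_cauchy R (fun n => u (n + m)%N) (fun n => s (n + m)%N) _ _.
- by move=> n k nk; apply: us; rewrite ?leq_addl // leq_add2r.
- by rewrite (cvg_shiftn m s).
have ul : u @ \oo --> l.
  apply/cvg_nm2 => e e0; have [n0 Hn0] := (cvgn_dist _ _).1 s0 e e0.
  exists (maxn n0 m) => n; rewrite geq_max => /andP[/Hn0 sn mn].
  have := Hl (n - m)%N; rewrite subnK // => /le_lt_trans; apply.
  by apply: le_lt_trans sn; rewrite sub0r normrN ler_norm.
have -> : C2_limit u = l.
  rewrite /C2_limit; case: xgetP => [l' _ ul'|/(_ l)/(_ ul) //].
  exact: cvg_nm2_unique ul' ul.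
by move=> n mn; have := Hl (n - m)%N; rewrite subnK.
Qed.

End limits.

(** * Shears, their inverses and the normalized orbit *)

Section shears.
Context {R : realType}.
Implicit Types (e : R) (b : bool) (p q : C2 R).

Definition shear e b q : C2 R :=
  if b then (e%:C%C * (q.2 : R[i]) ^+ 2, 0) else (0, e%:C%C * (q.1 : R[i]) ^+ 2).

Definition swap_if b q : C2 R := if b then (q.2, q.1) else q.

Lemma nm2_shear_diff e b p q : 0 <= e ->
  nm2 (shear e b p - shear e b q) <= e * (nm2 p + nm2 q) * nm2 (p - q).
Proof.
move=> e0.
have H (x y : R[i]) : nm x <= nm2 p -> nm y <= nm2 q -> nm (x - y) <= nm2 (p - q) ->
    nm (e%:C%C * x ^+ 2 - e%:C%C * y ^+ 2) <= e * (nm2 p + nm2 q) * nm2 (p - q).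
  move=> xp yq xy; rewrite -mulrBr subr_sqr nmM nmR ger0_norm // nmM -mulrA.
  rewrite ler_wpM2l // mulrC ler_pM ?nm_ge0 //.
  by rewrite (le_trans (nmD _ _)) // lerD.
have H0 : nm (0 - 0 : R[i]) <= e * (nm2 p + nm2 q) * nm2 (p - q).
  by rewrite subrr nm0 !mulr_ge0 ?addr_ge0 ?nm2_ge0.
case: b; rewrite nm2_le; apply/andP; split; try exact: H0.
  by apply: H; rewrite ?nm2_snd //; exact: (nm2_snd (p - q)).
by apply: H; rewrite ?nm2_fst //; exact: (nm2_fst (p - q)).
Qed.

Lemma shear0 e b : shear e b 0 = 0.
Proof. by case: b; rewrite /shear /= expr0n mulr0. Qed.

Lemma nm2_shear e b q : 0 <= e -> nm2 (shear e b q) <= e * nm2 q ^+ 2.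
Proof.
move=> e0; have := nm2_shear_diff b q 0 e0.
by rewrite shear0 !subr0 nm2_00 addr0 -mulrA -expr2.
Qed.

(** A shear reads one coordinate and changes the other; this makes [unshear] a two-sided inverse. *)
Lemma shear_shift e b q (s : R[i]) : shear e b (q + s *: shear e b q) = shear e b q.
Proof.
case: b; rewrite /shear /=.
  by congr (_ * _ ^+ 2, _); rewrite -[X in _ + X]/(s * 0) mulr0 addr0.
by congr (_, _ * _ ^+ 2); rewrite -[X in _ + X]/(s * 0) mulr0 addr0.
Qed.

Lemma nm2_swap_if b q : nm2 (swap_if b q) = nm2 q.
Proof. by case: b; rewrite // /nm2 /= maxC. Qed.

Lemma polymap_shearD e b (s : R[i]) (f : C2 R -> C2 R) : polymap f ->
  polymap (fun p => f p + s *: shear e b (f p)).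
Proof.
move=> [f1 f2]; case: b; split; apply: polyfun_add => //.
- by apply: polyfun_mul; [|apply: polyfun_mul; [|apply: polyfun_mul]] => //; exact:
    polyfun_cst.
- exact: (polyfun_mul (polyfun_cst s) (polyfun_cst 0)).
- exact: (polyfun_mul (polyfun_cst s) (polyfun_cst 0)).
- by apply: polyfun_mul; [|apply: polyfun_mul; [|apply: polyfun_mul]] => //; exact:
    polyfun_cst.
Qed.

Variable a : nat -> R.
Hypothesis a_gt0 : forall n, 0 < a n.

Definition coef_prod n : R := \prod_(j < n) a j.+1.

(** Forced by [(P x)^2 + A (P y) = P A (y + P / A x^2)], with [P] the product so far and [A] the
    next coefficient. *)
Definition shear_coef n : R := coef_prod n / a n.+1.

Lemma coef_prod_gt0 n : 0 < coef_prod n.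
Proof. by rewrite prodr_gt0. Qed.

Lemma shear_coef_gt0 n : 0 < shear_coef n.
Proof. by rewrite divr_gt0 ?coef_prod_gt0. Qed.

Let sh n := shear (shear_coef n) (odd n).

Let sh_ge0 n := ltW (shear_coef_gt0 n).

Fixpoint normalized_orbit n p : C2 R :=
  if n is m.+1 then normalized_orbit m p + sh m (normalized_orbit m p) else p.

Local Notation psi := normalized_orbit.

(* [normalized_orbit n] is the orbit map divided by its linear part, which is
   [coef_prod n] times the [n]-th iterate of the coordinate swap. *)
Lemma horbitE n p : horbit a n p = (coef_prod n)%:C%C *: swap_if (odd n) (psi n p).
Proof.
elim: n => [|n IH] /=; first by rewrite /coef_prod big_ord0 scale1r.
rewrite IH /coef_prod big_ord_recr /= -/(coef_prod n) rmorphM /sh /shear_coef.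
have an := realC_neq0 (a_gt0 n.+1).
have P0 := realC_neq0 (coef_prod_gt0 n).
have hE b (P A : R[i]) (x y : R[i]) : A != 0 -> P != 0 ->
  (((P *: swap_if b (x, y) : C2 R).1 : R[i]) ^+ 2 + A * ((P *: swap_if b (x, y) : C2
      R).2 : R[i]),
    A * ((P *: swap_if b (x, y) : C2 R).1 : R[i])) =
  P * A *: swap_if (~~ b) ((x, y) + (if b then (P / A * y ^+ 2, 0) else (0, P / A * x
      ^+ 2))) :> C2 R.
  move=> A0 Pn0; case: b; rewrite /swap_if /=.
    have E1 : (P * y) ^+ 2 + A * (P * x) = P * A * (x + P / A * y ^+ 2) by field.
    have E2 : A * (P * y) = P * A * (y + 0) by ring.
    exact: (f_equal2 pair E1 E2).
  have E1 : (P * x) ^+ 2 + A * (P * y) = P * A * (y + P / A * x ^+ 2) by field.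
  have E2 : A * (P * x) = P * A * (x + 0) by ring.
  exact: (f_equal2 pair E1 E2).
case: (psi n p) => x y; rewrite /henon hE // /shear rmorphM fmorphV.
by [].
Qed.

Lemma nm2_horbit n p : nm2 (horbit a n p) = coef_prod n * nm2 (psi n p).
Proof.
by rewrite horbitE nm2Z nmR gtr0_norm ?coef_prod_gt0 // nm2_swap_if.
Qed.

Lemma polymap_psi n : polymap (psi n).
Proof.
elim: n => [|n IH] /=; first exact: polymap_id.
have := polymap_shearD (shear_coef n) (odd n) 1 IH.
by rewrite (_ : (fun p => _) = fun p => psi n p + sh n (psi n p)) //; apply/funext =>
    p; rewrite scale1r.
Qed.

Definition unshear n q : C2 R := q - sh n q.

(** Undoes the shears of index [m] to [m + k - 1], the last one first. The start [m] is a parameter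
    because the estimates concern tails with small coefficients. *)
Fixpoint unshears m k q : C2 R :=
  if k is k'.+1 then unshears m k' (unshear (m + k') q) else q.

Lemma polymap_unshears m k (f : C2 R -> C2 R) : polymap f ->
  polymap (fun q => unshears m k (f q)).
Proof.
elim: k f => [|k IH] f pf //=.
apply: (IH (fun q => unshear (m + k) (f q))).
have := polymap_shearD (shear_coef (m + k)) (odd (m + k)) (-1) pf.
by rewrite (_ : (fun p => _) = fun p => unshear (m + k) (f p)) //; apply/funext => p;
    rewrite scaleN1r.
Qed.

Lemma unshears_recl m k q : unshears m k.+1 q = unshear m (unshears m.+1 k q).
Proof.
elim: k q => [|k IH] q; first by rewrite /= addn0.
by rewrite -[LHS]/(unshears m k.+1 (unshear (m + k.+1) q)) IH -addSnnS.
Qed.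

Lemma unshears_cat m k j q : unshears m (k + j) q = unshears m k (unshears (m + k) j q).
Proof.
elim: j q => [|j IH] q; first by rewrite addn0.
by rewrite addnS /= IH addnA.
Qed.

Lemma unshearK n q : unshear n (q + sh n q) = q.
Proof.
rewrite /unshear {2}/sh -[sh n q in X in _ - X]scale1r shear_shift.
by rewrite addrK.
Qed.

Lemma shearK n q : unshear n q + sh n (unshear n q) = q.
Proof.
by rewrite {2}/unshear -scaleN1r /sh shear_shift subrK.
Qed.

Lemma psiK n p : unshears 0 n (psi n p) = p.
Proof. by elim: n => [|n IH] //=; rewrite add0n unshearK. Qed.

Lemma unshearsK n q : psi n (unshears 0 n q) = q.
Proof. by elim: n q => [|n IH] q //=; rewrite IH add0n shearK. Qed.

Lemma unshears0 m k : unshears m k 0 = 0.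
Proof.
by elim: k => [|k IH] //=; rewrite /unshear /sh shear0 subr0 IH.
Qed.

(** * Quantitative convergence of the shear compositions *)

Variable N : nat.
Hypothesis shear_coef_decay : forall n, (N <= n)%N -> shear_coef n.+1 <= shear_coef n / 4.

(** A telescoping majorant: [sg n - sg n.+1] is at least the [n]-th shear coefficient, so [sg n]
    dominates the tail sum. *)
Let sg n := 2 * shear_coef n.

Let sg_ge0 n : 0 <= sg n.
Proof. by rewrite mulr_ge0 ?sh_ge0. Qed.

Let sgB n : (N <= n)%N -> shear_coef n <= sg n - sg n.+1.
Proof. by move=> Nn; have := shear_coef_decay Nn; have := shear_coef_gt0 n; rewrite
    /sg; lra. Qed.

Let sg_noninc n : (N <= n)%N -> sg n.+1 <= sg n.
Proof. by move=> /sgB; have := shear_coef_gt0 n; lra. Qed.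

Lemma shear_coef_cvg0 : shear_coef @ \oo --> 0.
Proof.
apply: (@geometric_cvg0 _ _ (1 / 4) N) => [||n Nn]; [lra|exact: sh_ge0|].
by rewrite mul1r mulrC shear_coef_decay.
Qed.

Let sg_small e : 0 < e -> exists2 m, (N <= m)%N & sg m <= e.
Proof.
move=> e0; have /cvgn_dist/(_ (e / 2))[|m Hm] := shear_coef_cvg0; first by rewrite divr_gt0.
exists (maxn N m); first exact: leq_maxl.
have := Hm _ (leq_maxr N m); rewrite sub0r normrN gtr0_norm ?shear_coef_gt0 // /sg.
by rewrite ltr_pdivlMr // mulrC => /ltW.
Qed.

Lemma psi_step n p B : nm2 (psi n p) <= B ->
  nm2 (psi n.+1 p - psi n p) <= B ^+ 2 * shear_coef n.
Proof.
move=> pB; rewrite /= addrAC subrr add0r (le_trans (nm2_shear _ _ (sh_ge0 n))) // mulrC.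
by rewrite ler_wpM2r // lerXn2r ?nnegrE ?nm2_ge0 // (le_trans (nm2_ge0 _) pB).
Qed.

(** A bootstrap: while the orbit stays within [2 B], its steps add up to at most [(2 B)^2 sg m],
    which the smallness hypothesis makes at most [B]. *)
Lemma psi_bound m p B : (N <= m)%N -> 4 * B * sg m <= 1 -> nm2 (psi m p) <= B ->
  forall k, nm2 (psi (m + k) p) <= 2 * B.
Proof.
move=> Nm Bm pB; have B0 : 0 <= B by rewrite (le_trans (nm2_ge0 _) pB).
have key k : (2 * B) ^+ 2 * (sg m - sg (m + k)) <= B.
  have E (x y : R) : (2 * B) ^+ 2 * (x - y) = B * (4 * B * x) - (2 * B) ^+ 2 * y by ring.
  rewrite E; have : B * (4 * B * sg m) <= B by rewrite ler_piMr.
  have : 0 <= (2 * B) ^+ 2 * sg (m + k) by rewrite mulr_ge0 ?sg_ge0 // exprn_ge0 ?mulr_ge0.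
  by lra.
suff H k : nm2 (psi (m + k) p) <= B + (2 * B) ^+ 2 * (sg m - sg (m + k)).
  by move=> k; have := H k; have := key k; lra.
elim: k => [|k IH]; first by rewrite addn0 subrr mulr0 addr0.
have Nmk : (N <= m + k)%N by rewrite (leq_trans Nm) // leq_addr.
have pk : nm2 (psi (m + k) p) <= 2 * B by have := key k; lra.
have := psi_step pk; rewrite addnS => st.
have := nm2D (psi (m + k).+1 p - psi (m + k) p) (psi (m + k) p); rewrite subrK => tri.
have b0 : 0 <= (2 * B) ^+ 2 by rewrite exprn_ge0 // mulr_ge0.
have := ler_wpM2l b0 (sgB Nmk).
rewrite !mulrBr in IH *; lra.
Qed.

Lemma psi_cauchy m p B : (N <= m)%N -> 4 * B * sg m <= 1 -> nm2 (psi m p) <= B ->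
  forall n k, (m <= n)%N -> (n <= k)%N ->
    nm2 (psi k p - psi n p) <= (2 * B) ^+ 2 * sg n.
Proof.
move=> Nm Bm pB n k mn nk; have B0 : 0 <= B by rewrite (le_trans (nm2_ge0 _) pB).
have b0 : 0 <= (2 * B) ^+ 2 by rewrite exprn_ge0 // mulr_ge0.
suff H j : nm2 (psi (n + j) p - psi n p) <= (2 * B) ^+ 2 * (sg n - sg (n + j)).
  rewrite -(subnKC nk) (le_trans (H _)) // ler_wpM2l // lerBlDr lerDl.
  exact: sg_ge0.
elim: j => [|j IH]; first by rewrite addn0 !subrr nm2_00 mulr0.
have mnj : (m <= n + j)%N by rewrite (leq_trans mn) // leq_addr.
have := psi_bound Nm Bm pB (n + j - m); rewrite subnKC // => /psi_step st.
have := ler_wpM2l b0 (sgB (leq_trans Nm mnj)).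
rewrite addnS; have := nm2_tri (psi (n + j) p) (psi (n + j).+1 p) (psi n p).
rewrite !mulrBr in IH *; lra.
Qed.

(** The same bootstrap, but the shear of smallest index acts last, so the induction lets [m] vary
    and passes from [m.+1] to [m] by [unshears_recl]. *)
Lemma unshears_bound m k q B : (N <= m)%N -> 4 * B * sg m <= 1 -> nm2 q <= B ->
  nm2 (unshears m k q) <= 2 * B /\
  nm2 (unshears m k q - q) <= (2 * B) ^+ 2 * (sg m - sg (m + k)).
Proof.
move=> + + qB; have B0 : 0 <= B by rewrite (le_trans (nm2_ge0 _) qB).
have b0 : 0 <= (2 * B) ^+ 2 by rewrite exprn_ge0 // mulr_ge0.
have fin m' d u : 4 * B * sg m' <= 1 -> 0 <= d ->
    nm2 (u - q) <= (2 * B) ^+ 2 * (sg m' - d) -> nm2 u <= 2 * B.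
  move=> Bm d0 uq; have := nm2D (u - q) q; rewrite subrK.
  have E : (2 * B) ^+ 2 * (sg m' - d) = B * (4 * B * sg m') - (2 * B) ^+ 2 * d by ring.
  have : B * (4 * B * sg m') <= B by rewrite ler_piMr.
  have : 0 <= (2 * B) ^+ 2 * d by rewrite mulr_ge0.
  by lra.
elim: k m => [|k IH] m Nm Bm.
  rewrite addn0 !subrr nm2_00 mulr0; split => //=.
  by rewrite (le_trans qB) // ler_peMl // ler1n.
have Bm1 : 4 * B * sg m.+1 <= 1.
  by rewrite (le_trans _ Bm) // ler_wpM2l ?mulr_ge0 // sg_noninc.
have [u2 uq] := IH m.+1 (leqW Nm) Bm1; rewrite unshears_recl.
set u := unshears m.+1 k q in u2 uq *.
have K : nm2 (unshear m u - q) <= (2 * B) ^+ 2 * (sg m - sg (m + k.+1)).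
  rewrite -addSnnS; have := nm2_tri u (unshear m u) q.
  have : nm2 (unshear m u - u) <= (2 * B) ^+ 2 * shear_coef m.
    rewrite /unshear addrAC subrr add0r nm2N (le_trans (nm2_shear _ _ (sh_ge0 m))) // mulrC.
    by rewrite ler_wpM2r // lerXn2r ?nnegrE ?nm2_ge0 ?mulr_ge0.
  have := ler_wpM2l b0 (sgB Nm); rewrite !mulrBr in uq *; lra.
by split => //; apply: fin Bm _ K.
Qed.

Lemma unshear_lipschitz m u v B : nm2 u <= B -> nm2 v <= B ->
  nm2 (unshear m u - unshear m v) <= (1 + 2 * B * shear_coef m) * nm2 (u - v).
Proof.
move=> uB vB; rewrite /unshear.
have -> : u - sh m u - (v - sh m v) = (u - v) - (sh m u - sh m v).
  by rewrite !opprB [sh m v - v]addrC addrACA [- sh m u + _]addrC.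
have := nm2D (u - v) (- (sh m u - sh m v)); rewrite nm2N.
have := nm2_shear_diff (odd m) u v (sh_ge0 m); rewrite -!/(sh m _).
have : shear_coef m * (nm2 u + nm2 v) * nm2 (u - v) <= 2 * B * shear_coef m * nm2 (u - v).
  rewrite ler_wpM2r ?nm2_ge0 // mulrC ler_wpM2r ?sh_ge0 //; lra.
rewrite mulrDl mul1r; lra.
Qed.

(** On the ball of radius [2 B] each factor has Lipschitz constant [1 + 4 B e_j]. As long as the
    product is at most 2, a new factor adds at most [8 B e_m], which telescopes through [sg]. *)
Lemma unshears_lipschitz m k u v B : (N <= m)%N -> 8 * B * sg m <= 1 ->
  nm2 u <= B -> nm2 v <= B ->
  nm2 (unshears m k u - unshears m k v) <= 2 * nm2 (u - v).
Proof.
move=> + + uB vB; have B0 : 0 <= B by rewrite (le_trans (nm2_ge0 _) uB).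
move=> Nm Bm.
suff H : nm2 (unshears m k u - unshears m k v) <=
    (1 + 8 * B * (sg m - sg (m + k))) * nm2 (u - v).
  rewrite (le_trans H) // ler_wpM2r ?nm2_ge0 //.
  have : 0 <= 8 * B * sg (m + k) by rewrite mulr_ge0 ?sg_ge0 // mulr_ge0.
  by rewrite mulrBr; lra.
elim: k m Nm Bm => [|k IH] m Nm Bm; first by rewrite addn0 subrr mulr0 addr0 mul1r.
have Bm1 : 8 * B * sg m.+1 <= 1.
  by rewrite (le_trans _ Bm) // ler_wpM2l ?mulr_ge0 // sg_noninc.
have half m' : 8 * B * sg m' <= 1 -> 4 * B * sg m' <= 1.
  have : 0 <= B * sg m' by rewrite mulr_ge0.
  by lra.
have [u2 _] := unshears_bound k (leqW Nm) (half _ Bm1) uB.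
have [v2 _] := unshears_bound k (leqW Nm) (half _ Bm1) vB.
rewrite !unshears_recl (le_trans (unshear_lipschitz m u2 v2)) //.
have e0 := sh_ge0 m.
rewrite (le_trans (ler_wpM2l _ (IH _ (leqW Nm) Bm1))) //.
  by rewrite addr_ge0 // mulr_ge0 ?sh_ge0 // !mulr_ge0.
rewrite mulrA ler_wpM2r ?nm2_ge0 // -addSnnS.
have s1 : 8 * B * (sg m.+1 - sg (m.+1 + k)) <= 1.
  have : 0 <= 8 * B * sg (m.+1 + k) by rewrite mulr_ge0 ?sg_ge0 // mulr_ge0.
  by rewrite mulrBr; lra.
have := ler_wpM2l (mulr_ge0 (ler0n R 8) B0) (sgB Nm).
set x := 8 * B * _ in s1 *.
have := ler_wpM2l (mulr_ge0 (mulr_ge0 (ler0n R 4) B0) e0) s1.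
have -> : 8 * B * (sg m - sg (m.+1 + k)) = 8 * B * (sg m - sg m.+1) + x.
  by rewrite /x -mulrDr addrA subrK.
move: (8 * B * (sg m - sg m.+1)) s1 => z; clearbody x; lra.
Qed.

(** The first shears need not have small coefficients; being finitely many, they cost a constant
    depending on [m] and [B]. *)
Lemma unshears0_lipschitz m B : exists2 C, 0 <= C & forall u v, nm2 u <= B -> nm2 v <= B ->
  nm2 (unshears 0 m u - unshears 0 m v) <= C * nm2 (u - v).
Proof.
elim: m B => [|m IH] B; first by exists 1 => // u v _ _; rewrite mul1r.
have [B0|B0] := ltP B 0.
  by exists 0 => // u v uB; have := lt_le_trans B0 (le_trans (nm2_ge0 u) uB); rewrite ltxx.
have [C C0 HC] := IH (B + shear_coef m * B ^+ 2).
exists (C * (1 + 2 * B * shear_coef m)).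
  by rewrite mulr_ge0 // addr_ge0 // mulr_ge0 ?sh_ge0 // mulr_ge0.
have bd u : nm2 u <= B -> nm2 (unshear m u) <= B + shear_coef m * B ^+ 2.
  move=> uB; rewrite /unshear (le_trans (nm2D _ _)) // nm2N lerD //.
  rewrite (le_trans (nm2_shear _ _ (sh_ge0 m))) // ler_wpM2l ?sh_ge0 //.
  by rewrite lerXn2r ?nnegrE ?nm2_ge0.
move=> u v uB vB /=; rewrite (le_trans (HC _ _ (bd _ uB) (bd _ vB))) //.
by rewrite -mulrA ler_wpM2l // unshear_lipschitz.
Qed.

(** In the inverse compositions a new shear acts first, on the argument, so consecutive terms are
    compared by an equi-Lipschitz bound at the nearby points [unshear n u] and [u]. That bound
    combines a crude constant for the first [m] factors with a factor 2 for the others. *)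
Lemma unshears_uniform B : exists m C, [/\ (N <= m)%N, 0 <= C,
  (forall n u v, (m <= n)%N -> nm2 u <= B -> nm2 v <= B ->
     nm2 (unshears 0 n u - unshears 0 n v) <= C * nm2 (u - v)) &
  (forall n k u, (m <= n)%N -> (n <= k)%N -> nm2 u <= B ->
     nm2 (unshears 0 k u - unshears 0 n u) <= C * sg n)].
Proof.
(* At least 1 even for negative [B]; the estimates below use radius [2 * B'], which leaves room for
   [unshear (n + j) u]. *)
pose B' := Order.max B 0 + 1.
have BB' : B <= B' - 1 by rewrite /B' addrK le_max lexx.
have B'1 : 1 <= B' by rewrite /B' lerDr le_max lexx orbT.
have B'0 : 0 < B' by apply: lt_le_trans B'1.
have [|m Nm sm] := @sg_small (1 / (16 * B')); first by rewrite divr_gt0 // mulr_gt0.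
have {}sm : 8 * (2 * B') * sg m <= 1.
  by move: sm; rewrite ler_pdivlMr ?mulr_gt0 // => sm; apply: le_trans sm; lra.
have [C C0 HC] := unshears0_lipschitz m (2 * (2 * B')).
have sm4 : 4 * (2 * B') * sg m <= 1.
  have : 0 <= B' * sg m by rewrite mulr_ge0 // ltW.
  by lra.
have lip n u v : (m <= n)%N -> nm2 u <= 2 * B' -> nm2 v <= 2 * B' ->
    nm2 (unshears 0 n u - unshears 0 n v) <= C * 2 * nm2 (u - v).
  move=> mn uB vB; rewrite -(subnKC mn) !unshears_cat !add0n.
  have [u2 _] := unshears_bound (n - m) Nm sm4 uB.
  have [v2 _] := unshears_bound (n - m) Nm sm4 vB.
  by rewrite (le_trans (HC _ _ u2 v2)) // -mulrA ler_wpM2l // (unshears_lipschitz _ Nm sm).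
exists m, (C * 2 * (1 + B' ^+ 2)); split => //.
- by rewrite mulr_ge0 ?mulr_ge0 // addr_ge0 // exprn_ge0 // ltW.
- move=> n u v mn uB vB; rewrite (le_trans (lip _ _ _ mn _ _)) ?(le_trans uB)
    ?(le_trans vB) //; try lra.
  rewrite ler_wpM2r ?nm2_ge0 // ler_peMr ?mulr_ge0 // lerDl exprn_ge0 // ltW //.
move=> n k u mn nk uB.
have b0 : 0 <= C * 2 * (1 + B' ^+ 2).
  by rewrite mulr_ge0 ?mulr_ge0 // addr_ge0 // exprn_ge0 // ltW.
suff H j : nm2 (unshears 0 (n + j) u - unshears 0 n u) <= C * 2 * (1 + B' ^+ 2) * (sg n
    - sg (n + j)).
  rewrite -(subnKC nk) (le_trans (H _)) // ler_wpM2l // lerBlDr lerDl.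
  exact: sg_ge0.
elim: j => [|j IH]; first by rewrite addn0 !subrr nm2_00 mulr0.
have mnj : (m <= n + j)%N by rewrite (leq_trans mn) // leq_addr.
have uB' : nm2 u <= B' by rewrite (le_trans uB) //; lra.
have e0 := shear_coef_gt0 (n + j).
have Du : nm2 (unshear (n + j) u - u) <= B' ^+ 2 * shear_coef (n + j).
  rewrite /unshear addrAC subrr add0r nm2N (le_trans (nm2_shear _ _ (sh_ge0 _))) // mulrC.
  by rewrite ler_wpM2r ?sh_ge0 // lerXn2r ?nnegrE ?nm2_ge0 // ltW.
have eB : B' * shear_coef (n + j) <= 1.
  have sgm : sg (n + j) <= sg m.
    rewrite -(subnKC mnj); elim: (n + j - m)%N => [|i Hi]; first by rewrite addn0.
    by rewrite addnS (le_trans (sg_noninc _)) // (leq_trans Nm) // leq_addr.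
  have : 0 <= B' * sg m by rewrite mulr_ge0 // ltW.
  have := ler_wpM2l (ltW B'0) sgm; rewrite {1}/sg; lra.
have u2 : nm2 (unshear (n + j) u) <= 2 * B'.
  have := nm2D (unshear (n + j) u - u) u; rewrite subrK.
  have : B' ^+ 2 * shear_coef (n + j) <= B'.
    by rewrite expr2 -mulrA ler_piMr // ltW.
  by lra.
have stp : nm2 (unshears 0 (n + j).+1 u - unshears 0 (n + j) u) <=
    C * 2 * (1 + B' ^+ 2) * shear_coef (n + j).
  rewrite /= add0n (le_trans (lip _ _ _ mnj u2 _)) //; first by lra.
  rewrite -[leRHS]mulrA ler_wpM2l ?mulr_ge0 // (le_trans Du) //.
  by rewrite ler_wpM2r ?sh_ge0 // lerDr.
have := ler_wpM2l b0 (sgB (leq_trans Nm mnj)).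
rewrite addnS; have := nm2_tri (unshears 0 (n + j) u) (unshears 0 (n + j).+1 u)
    (unshears 0 n u).
rewrite !(mulrBr (C * 2 * (1 + B' ^+ 2))) in IH *; lra.
Qed.

(** * The limit map on the basin and its inverse *)

Section biholomorphism.

Local Notation Om := (orbit_basin a).

Hypothesis aN : forall n, (N <= n)%N -> a n <= 1 / 4.
Hypothesis a_slow : forall n, exists k, (1 / 2) ^+ (2 ^ k) <= a (n + k).+1.

Lemma nm2_henon e p : 0 <= e -> nm2 (henon e p) <= nm2 p ^+ 2 + e * nm2 p.
Proof.
move=> e0; have p1 := nm2_fst p; have p2 := nm2_snd p; have p0 := nm2_ge0 p.
rewrite nm2_le; apply/andP; split.
  rewrite (le_trans (nmD _ _)) // nmX nmM nmR ger0_norm // lerD //.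
    by rewrite lerXn2r ?nnegrE ?nm_ge0.
  by rewrite ler_wpM2l.
rewrite [X in X <= _]nmM nmR ger0_norm // (le_trans (ler_wpM2l e0 p1)) //.
by rewrite lerDr exprn_ge0.
Qed.

(* Either some [shear_coef n * nm2 (psi n p)] drops below [1], after which it
   decays geometrically, or [nm2 (horbit n p)] is squared at each step, hence
   is doubly exponentially small, against [a_slow]. *)
Lemma basin_small_psi p : Om p ->
  exists2 m, (N <= m)%N & 8 * (shear_coef m * nm2 (psi m p)) <= 1.
Proof.
move=> /cvg_nm2/(_ (1 / 4))[|n0 Hn0]; first by rewrite divr_gt0.
pose r n := shear_coef n * nm2 (psi n p); pose n1 := maxn N n0.
have r0 n : 0 <= r n by rewrite mulr_ge0 ?nm2_ge0 ?sh_ge0.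
have Nn1 n : (n1 <= n)%N -> (N <= n)%N by apply: leq_trans; exact: leq_maxl.
have rS n : (N <= n)%N -> r n.+1 <= r n * (1 + r n) / 4.
  move=> Nn; have d := shear_coef_decay Nn; rewrite /r.
  have := psi_step (lexx (nm2 (psi n p))).
  have := nm2D (psi n.+1 p - psi n p) (psi n p); rewrite subrK.
  have := nm2_ge0 (psi n.+1 p); have := nm2_ge0 (psi n p).
  have := shear_coef_gt0 n; have := shear_coef_gt0 n.+1.
  move: (nm2 (psi n.+1 p - psi n p)) (nm2 (psi n.+1 p)) (nm2 (psi n p))
    (shear_coef n.+1) (shear_coef n) d => z y x e' e d.
  move=> e'0 e0 x0 y0 h1 h2.
  have h3 : y <= x + x ^+ 2 * e by lra.
  apply: (@le_trans _ _ (e / 4 * (x + x ^+ 2 * e))); first by rewrite ler_pM // ltW.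
  by rewrite (_ : e / 4 * _ = e * x * (1 + e * x) / 4) //; field.
have uE n : nm2 (horbit a n p) = r n * a n.+1.
  by rewrite nm2_horbit /r /shear_coef mulrAC divfK // gt_eqF.
have [[n nn rn]|H] := pselect (exists2 n, (n1 <= n)%N & r n <= 1).
  have dec k : r (n + k)%N <= (1 / 2) ^+ k.
    elim: k => [|k IH]; first by rewrite addn0 expr0.
    have k1 : (1 / 2 : R) ^+ k <= 1 by rewrite exprn_ile1 //; lra.
    have := rS (n + k)%N; rewrite addnS exprS => /(_ _)/le_trans -> //.
      by rewrite (leq_trans (Nn1 _ nn)) // leq_addr.
    by have := r0 (n + k)%N; nra.
  (* While [r <= 1], each step at least halves it; three steps reach [1 / 8]. *)
  exists (n + 3)%N; first by rewrite (leq_trans (Nn1 _ nn)) // leq_addr.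
  by have := dec 3%N; rewrite -/(r _) !exprS expr0; lra.
have rgt n : (n1 <= n)%N -> 1 < r n.
  by move=> nn; rewrite ltNge; apply/negP => rn; apply: H; exists n.
pose u n := nm2 (horbit a n p).
have u0 n : 0 <= u n by exact: nm2_ge0.
have au n : (n1 <= n)%N -> a n.+1 < u n.
  by move=> nn; rewrite /u uE ltr_pMl // rgt.
(* [1 < r n] means [a n.+1 < u n], so the linear term is dominated by the square and
   [u n.+1 <= 2 (u n)^2]. *)
have uS n : (n1 <= n)%N -> 2 * u n.+1 <= (2 * u n) ^+ 2.
  move=> nn; have := nm2_henon (horbit a n p) (ltW (a_gt0 n.+1)).
  have := au _ nn; have := u0 n; rewrite -/(u n) -/(u n.+1); nra.
have un k : 2 * u (n1 + k)%N <= (1 / 2) ^+ (2 ^ k).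
  elim: k => [|k IH].
    rewrite addn0 expn0 expr1; have := Hn0 n1 (leq_maxr _ _).
    by rewrite subr0 -/(u n1); lra.
  rewrite addnS (le_trans (uS _ (leq_addr _ _))) // expnSr exprM.
  by rewrite lerXn2r ?nnegrE ?mulr_ge0 // exprn_ge0.
have [k Hk] := a_slow n1.
have := un k; have := au (n1 + k)%N (leq_addr _ _); have := u0 (n1 + k)%N; lra.
Qed.

(** In norm the orbit is [coef_prod n] times the normalized one, and this product tends to [0]. *)
Lemma bounded_psi_basin p B n0 : (forall n, (n0 <= n)%N -> nm2 (psi n p) <= B) -> Om p.
Proof.
move=> pB; have P0 : coef_prod @ \oo --> 0.
  apply: (@geometric_cvg0 _ _ (1 / 4) N) => [||n Nn]; first by lra.
    by move=> n; exact: ltW (coef_prod_gt0 n).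
  rewrite /coef_prod big_ord_recr /= mulrC ler_wpM2r ?aN ?(leqW Nn) //.
  exact: ltW (coef_prod_gt0 n).
have B1 : 0 < `|B| + 1 by rewrite ltr_wpDl.
apply/cvg_nm2 => e e0; have [m Hm] := (cvgn_dist _ _).1 P0 _ (divr_gt0 e0 B1).
exists (maxn n0 m) => n; rewrite geq_max => /andP[/pB nB /Hm].
rewrite sub0r normrN gtr0_norm ?coef_prod_gt0 // ltr_pdivlMr // => P1.
rewrite subr0 nm2_horbit (le_lt_trans _ P1) // ler_wpM2l ?(ltW (coef_prod_gt0 n)) //.
by rewrite (le_trans nB) // (le_trans (ler_norm _)) // lerDl.
Qed.

(** [basin_small_psi] supplies the hypothesis of [psi_bound] for [B = nm2 (psi m p)], so the
    normalized orbit is bounded. A later index affords a larger [B] and a strict inequality, which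
    extends to a neighbourhood of [p]. *)
Lemma basin_psi_bound p : Om p -> exists m B, [/\ (N <= m)%N, 0 < B, nm2 (psi m p) < B
    & 4 * B * sg m <= 1].
Proof.
move=> /basin_small_psi[m Nm rm].
have [m' mm' Hm'] : exists2 m', (m <= m')%N & 8 * (shear_coef m' * (2 * nm2 (psi m p) +
    1)) <= 1.
  have P0 := nm2_ge0 (psi m p).
  have K0 : 0 < 8 * (2 * nm2 (psi m p) + 1) by lra.
  have /cvgn_dist/(_ _ (divr_gt0 ltr01 K0))[m' Hm'] := shear_coef_cvg0.
  exists (maxn m m'); first exact: leq_maxl.
  have := Hm' _ (leq_maxr m m'); rewrite sub0r normrN gtr0_norm ?shear_coef_gt0 //.
  by rewrite ltr_pdivlMr // => /ltW; rewrite mulrCA.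
have P0 := nm2_ge0 (psi m p).
exists m', (2 * nm2 (psi m p) + 1); split.
- exact: leq_trans mm'.
- by lra.
- have b4 : 4 * nm2 (psi m p) * sg m <= 1 by rewrite /sg; lra.
  have := psi_bound Nm b4 (lexx _) (m' - m); rewrite subnKC // => h; lra.
- rewrite /sg; lra.
Qed.

Definition psi_limit p := C2_limit (psi^~ p).

Definition unshears_limit q := C2_limit (unshears 0^~ q).

Lemma scaled_shear_coef_cvg0 (C : R) : (fun n => C * sg n) @ \oo --> 0.
Proof.
rewrite (_ : (fun n => _) = fun n => C * 2 * shear_coef n); last first.
  by apply/funext => n; rewrite /sg mulrA.
rewrite -(mulr0 (C * 2)); apply: cvgMr; exact: shear_coef_cvg0.
Qed.

Lemma psi_limit_near p : Om p -> exists m B d, [/\ (N <= m)%N, 0 < d &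
  forall h, nm2 h <= d -> [/\ (forall n, (m <= n)%N -> nm2 (psi n (p + h)) <= B),
   (forall n k, (m <= n)%N -> (n <= k)%N -> nm2 (psi k (p + h) - psi n (p + h)) <= B ^+
       2 * sg n) &
   (forall n, (m <= n)%N -> nm2 (psi n (p + h) - psi_limit (p + h)) <= B ^+ 2 * sg n)]].
Proof.
move=> /basin_psi_bound[m [B [Nm B0 pB Bm]]].
have pc : {for p, continuous (psi m)}.
  by apply: differentiable_continuous; apply: polymap_differentiable; exact: polymap_psi.
have eB : 0 < B - nm2 (psi m p) by rewrite subr_gt0.
have [d d0 Hd] := (continuous_nm2 _ _).1 pc _ eB.
exists m, (2 * B), (d / 2); split; rewrite ?divr_gt0 // => h hd.
have phB : nm2 (psi m (p + h)) <= B.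
  have /Hd : nm2 (p + h - p) < d by rewrite addrAC subrr add0r; lra.
  by have := nm2D (psi m (p + h) - psi m p) (psi m p); rewrite subrK; lra.
have cau := psi_cauchy Nm Bm phB.
split => //.
  move=> n mn; have := psi_bound Nm Bm phB (n - m); by rewrite subnKC.
by apply: C2_limit_cauchy => //; exact: scaled_shear_coef_cvg0.
Qed.

Lemma psi_limit_holo : holo_on Om psi_limit.
Proof.
move=> p /psi_limit_near[m [B [d [Nm d0 H]]]].
apply: (@weierstrass R (fun n => psi (n + m)) psi_limit p d B (fun n => B ^+ 2 * sg (n
    + m))) => //.
- by move=> n; exact: polymap_psi.
- by move=> n h /H[pB _ _]; apply: pB; rewrite leq_addl.
- by move=> n k h nk /H[_ cau _]; apply: cau; rewrite ?leq_addl // leq_add2r.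
- by move=> n h /H[_ _ lim]; apply: lim; rewrite leq_addl.
- by rewrite (cvg_shiftn m (fun n => B ^+ 2 * sg n)); exact: scaled_shear_coef_cvg0.
Qed.

Lemma unshears_limit_uniform B : exists m C, [/\ (N <= m)%N, 0 <= C,
  (forall n u v, (m <= n)%N -> nm2 u <= B -> nm2 v <= B ->
     nm2 (unshears 0 n u - unshears 0 n v) <= C * nm2 (u - v)),
  (forall n k u, (m <= n)%N -> (n <= k)%N -> nm2 u <= B ->
     nm2 (unshears 0 k u - unshears 0 n u) <= C * sg n) &
  (forall n u, (m <= n)%N -> nm2 u <= B ->
     nm2 (unshears 0 n u - unshears_limit u) <= C * sg n)].
Proof.
have [m [C [Nm C0 lip cau]]] := unshears_uniform B.
exists m, C; split => // n u mn uB.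
apply: (@C2_limit_cauchy R (unshears 0^~ u) m (fun n => C * sg n)) => //.
  by move=> n' k' mn' nk'; exact: cau.
exact: scaled_shear_coef_cvg0.
Qed.

Lemma unshears_limit_holo : holo_on setT unshears_limit.
Proof.
move=> q _; have [m [C [Nm C0 lip cau lim]]] := unshears_limit_uniform (nm2 q + 1).
have qh h : nm2 h <= 1 -> nm2 (q + h) <= nm2 q + 1.
  by move=> h1; rewrite (le_trans (nm2D _ _)) // lerD2l.
(* The bound [C * (nm2 q + 1)] is the Lipschitz estimate against the common fixed point [0]. *)
apply: (@weierstrass R (fun n => unshears 0 (n + m)) unshears_limit q 1 (C * (nm2 q + 1))
  (fun n => C * sg (n + m))) => //.
- by move=> n; exact: (polymap_unshears 0 (n + m) polymap_id).
- move=> n h h1; have := lip (n + m)%N (q + h) 0 (leq_addl _ _) (qh h h1).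
  rewrite unshears0 !subr0 nm2_00 => /(_ _)/le_trans; apply.
    by rewrite addr_ge0 ?nm2_ge0.
  by rewrite ler_wpM2l // qh.
- by move=> n k h nk h1; apply: cau; rewrite ?leq_addl ?leq_add2r ?qh.
- by move=> n h h1; apply: lim; rewrite ?leq_addl ?qh.
- by rewrite (cvg_shiftn m (fun n => C * sg n)); exact: scaled_shear_coef_cvg0.
Qed.

Lemma eps_le0 (x : R) : (forall e, 0 < e -> x <= e) -> x <= 0.
Proof. by move=> H; apply/ler_addgt0Pr => e e0; rewrite add0r H. Qed.

(** For fixed large [n], [psi n] cancels the first [n] inverse shears and the others move [q] by at
    most [(2 nm2 q)^2 sg n]; continuity of [psi n] carries this bound to the limit [g]. Boundedness
    puts [g] in the basin, and the rate identifies the limit as [q]. *)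
Lemma unshears_limitK q : Om (unshears_limit q) /\ psi_limit (unshears_limit q) = q.
Proof.
have [m0 [C [_ C0 _ _ lim]]] := unshears_limit_uniform (nm2 q).
set g := unshears_limit q in lim *.
have [|m Nm sm] := @sg_small (1 / (4 * (nm2 q + 1))).
  by rewrite divr_gt0 // mulr_gt0 // ltr_wpDl ?nm2_ge0.
have q0 := nm2_ge0 q.
have sgm n : (m <= n)%N -> sg n <= sg m.
  move=> mn; rewrite -(subnKC mn); elim: (n - m)%N => [|i Hi]; first by rewrite addn0.
  by rewrite addnS (le_trans (sg_noninc _)) // (leq_trans Nm) // leq_addr.
have near n : (m <= n)%N -> nm2 (psi n g - q) <= (2 * nm2 q) ^+ 2 * sg n.
  move=> mn; apply/ler_addgt0Pr => e e0.
  have pc : {for g, continuous (psi n)}.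
    by apply: differentiable_continuous; apply: polymap_differentiable; exact: polymap_psi.
  have [d d0 Hd] := (continuous_nm2 _ _).1 pc _ e0.
  have [k0 Hk0] := (cvgn_dist _ _).1 (scaled_shear_coef_cvg0 C) d d0.
  pose k := maxn n (maxn m0 k0).
  have nk : (n <= k)%N by exact: leq_maxl.
  have m0k : (m0 <= k)%N by rewrite /k maxnCA leq_maxl.
  have k0k : (k0 <= k)%N by rewrite /k maxnA leq_maxr.
  have /Hd pk : nm2 (unshears 0 k q - g) < d.
    apply: (le_lt_trans (lim _ _ m0k (lexx _))).
    by have := Hk0 _ k0k; rewrite sub0r normrN; apply: le_lt_trans; exact: ler_norm.
  have E : psi n (unshears 0 k q) = unshears n (k - n) q.
    by rewrite -{1}(subnKC nk) unshears_cat add0n unshearsK.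
  rewrite E in pk.
  have Bn : 4 * nm2 q * sg n <= 1.
    move: sm; rewrite ler_pdivlMr; last by rewrite mulr_gt0 // ltr_wpDl.
    have := sgm n mn; have := sg_ge0 n; nra.
  have [_ b] := unshears_bound (k - n) (leq_trans Nm mn) Bn (lexx (nm2 q)).
  have b0 : 0 <= (2 * nm2 q) ^+ 2 * sg (n + (k - n)) by rewrite mulr_ge0 // exprn_ge0
      // mulr_ge0.
  rewrite mulrBr in b.
  have := nm2_tri (unshears n (k - n) q) (psi n g) q.
  by rewrite (nm2BC (psi n g) (unshears n (k - n) q)); lra.
have gO : Om g.
  apply: (@bounded_psi_basin _ (nm2 q + (2 * nm2 q) ^+ 2 * sg m) m) => n mn.
  have := nm2D (psi n g - q) q; rewrite subrK => /le_trans; apply.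
  rewrite addrC lerD2l (le_trans (near n mn)) // ler_wpM2l ?sgm //.
  by rewrite exprn_ge0 // mulr_ge0.
split => //; have [m1 [B [d [_ d0 H]]]] := psi_limit_near gO.
have [|_ _ plim] := H 0; first by rewrite nm2_00 ltW.
rewrite addr0 in plim.
apply/subr0_eq/nm2_eq0/eps_le0 => e e0.
have e2 : 0 < e / 2 by rewrite divr_gt0.
have [k1 Hk1] := (cvgn_dist _ _).1 (scaled_shear_coef_cvg0 (B ^+ 2)) _ e2.
have [k2 Hk2] := (cvgn_dist _ _).1 (scaled_shear_coef_cvg0 ((2 * nm2 q) ^+ 2)) _ e2.
pose k := maxn (maxn m m1) (maxn k1 k2).
have h1 := Hk1 k; have h2 := Hk2 k.
have := plim k; have := near k.
rewrite /k !leq_max !leqnn ?orbT in h1 h2 *.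
move=> /(_ isT) A1 /(_ isT) A2; move: (h1 isT) (h2 isT); rewrite !sub0r !normrN.
move=> /(le_lt_trans (ler_norm _)) A3 /(le_lt_trans (ler_norm _)) A4.
have := nm2_tri (psi k g) (psi_limit g) q; rewrite (nm2BC (psi_limit g) (psi k g)) => A5.
by rewrite -/k in A1 A2 A3 A4; lra.
Qed.

(** [unshears 0 k] sends [psi k p] back to [p] exactly; the equi-Lipschitz bound allows replacing
    [psi k p] by its limit. *)
Lemma psi_limitK p : Om p -> unshears_limit (psi_limit p) = p.
Proof.
move=> pO; have [m1 [B [d [_ d0 H]]]] := psi_limit_near pO.
have [|pB _ plim] := H 0; first by rewrite nm2_00 ltW.
rewrite addr0 in pB plim; set q := psi_limit p in plim *.
have [m2 [C [_ C0 lip _ lim]]] := unshears_limit_uniform (Order.max B (nm2 q)).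
apply/subr0_eq/nm2_eq0/eps_le0 => e e0.
have e2 : 0 < e / 2 by rewrite divr_gt0.
have [k1 Hk1] := (cvgn_dist _ _).1 (scaled_shear_coef_cvg0 (C * B ^+ 2)) _ e2.
have [k2 Hk2] := (cvgn_dist _ _).1 (scaled_shear_coef_cvg0 C) _ e2.
pose k := maxn (maxn m1 m2) (maxn k1 k2).
have km1 : (m1 <= k)%N by rewrite /k !leq_max leqnn.
have km2 : (m2 <= k)%N by rewrite /k !leq_max leqnn !orbT.
have kk1 : (k1 <= k)%N by rewrite /k !leq_max leqnn !orbT.
have kk2 : (k2 <= k)%N by rewrite /k !leq_max leqnn !orbT.
have := Hk1 _ kk1; have := Hk2 _ kk2; rewrite !sub0r !normrN.
move=> /(le_lt_trans (ler_norm _)) A1 /(le_lt_trans (ler_norm _)) A2.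
have qm : nm2 q <= Order.max B (nm2 q) by rewrite le_max lexx orbT.
have pm : nm2 (psi k p) <= Order.max B (nm2 q) by rewrite le_max pB.
have := lim k q km2 qm; have := lip k (psi k p) q km2 pm qm.
rewrite psiK => A3 A4.
have := ler_wpM2l C0 (plim k km1); rewrite mulrA => A5.
have := nm2_tri (unshears 0 k q) (unshears_limit q) p.
rewrite (nm2BC (unshears_limit q) (unshears 0 k q)) (nm2BC (unshears 0 k q) p); lra.
Qed.

Lemma basin_fatou_bieberbach : fatou_bieberbach Om.
Proof.
split.
- exact: (basin_domain a_gt0 aN).
- apply/eqP => OT; have : Om (1%:C%C, 0) by rewrite OT.
  move=> /cvg_nm2/(_ 1 ltr01)[n0 /(_ n0 (leqnn _))]; rewrite subr0.
  have [y [w [E y1 w0]]] := orbit_real a_gt0 n0 (@ler01 R).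
  rewrite expr1n in y1; rewrite E nm2_lt -[nm (_, _).1]/(nm y%:C%C) nmR ger0_norm
      ?(le_trans ler01) //.
  by rewrite ltNge y1.
- exists psi_limit, unshears_limit; split.
  + exact: psi_limit_holo.
  + exact: unshears_limit_holo.
  + by move=> p pO; split => //; exact: psi_limitK.
  + by move=> q _; exact: unshears_limitK.
Qed.

End biholomorphism.
End shears.

(** * The choice of exponents *)

Section exponents.
Context {R : realType}.

Lemma linear_le_expR (e : R) : 0 < e -> exists n0, forall n, (n0 <= n)%N ->
  ln (n.+1%:R) <= e * n%:R.
Proof.
move=> e0; have e4 : 0 <= 4 / e ^+ 2 by rewrite divr_ge0 // exprn_ge0 // ltW.
(* For [n >= 4 / e^2] one has [n + 1 <= (1 + e n / 2)^2 <= exp (e n)]. *)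
exists (Num.truncn (4 / e ^+ 2)).+1 => n nn.
have n4 : 4 / e ^+ 2 <= n%:R.
  by rewrite (le_trans (ltW (truncnS_gt _))) // ler_nat.
have n0 : 0 <= n%:R :> R by exact: ler0n.
rewrite -[leRHS]expRK ler_ln ?posrE ?ltr0n ?expR_gt0 //.
have -> : e * n%:R = e * n%:R / 2 + e * n%:R / 2 by lra.
rewrite expRD; have := expR_ge1Dx (e * n%:R / 2).
have en : 0 <= e * n%:R by rewrite mulr_ge0 // ltW.
move: (expR _) => x xge.
have : (1 + e * n%:R / 2) ^+ 2 <= x * x by rewrite -expr2 lerXn2r ?nnegrE //; lra.
apply: le_trans; rewrite -natr1.
have : 4 <= n%:R * e ^+ 2 by rewrite -ler_pdivrMr // exprn_gt0.
move: n%:R n0 en => y y0 ey H; have : 4 * y <= y * e ^+ 2 * y by rewrite ler_wpM2r.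
nra.
Qed.

(* At [n = 0] the division by [0] gives [texp s 0 = 2], so that the formula
   for [texp s n ^+ n] also holds there. *)
Definition texp (s : R) (n : nat) : R := 2 * expR (s * ln n.+1%:R / n%:R).

Lemma texp_gt0 s n : 0 < texp s n.
Proof. by rewrite mulr_gt0 // expR_gt0. Qed.

Lemma texp_cvg s : texp s @ \oo --> (2 : R).
Proof.
suff H : (fun n => s * ln n.+1%:R / n%:R) @ \oo --> (0 : R).
  have H1 : (fun=> 2 : R) @ \oo --> (2 : R) by exact: cvg_cst.
  have H2 : (fun n => expR (s * ln n.+1%:R / n%:R)) @ \oo --> expR (0 : R).
    by apply: continuous_cvg H; exact: continuous_expR.
  have := cvgM H1 H2; rewrite expR0 mulr1; apply.
apply/cvgn_dist => e e0.
have s0 : 0 < `|s| + 1 by rewrite ltr_wpDl.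
have [n0 Hn0] := linear_le_expR (divr_gt0 e0 s0).
exists n0.+1 => n nn; have np : 0 < n%:R :> R by rewrite ltr0n (leq_trans _ nn).
rewrite sub0r normrN !normrM normfV (gtr0_norm np) ltr_pdivrMr //.
have l0 : 0 <= ln n.+1%:R :> R by rewrite ln_ge0 // ler1n.
rewrite (ger0_norm l0).
have := Hn0 n (ltnW nn); rewrite mulrAC ler_pdivlMr // => H.
have [l1|l1] := eqVneq (ln n.+1%:R : R) 0; first by rewrite l1 mulr0 mulr_gt0.
apply: lt_le_trans H; rewrite mulrC ltr_pM2l ?ltrDl //.
by rewrite lt_def l1 l0.
Qed.

Lemma texpX s n : texp s n ^+ n = 2 ^+ n * expR (s * ln n.+1%:R).
Proof.
rewrite /texp exprMn -expRM_natl; congr (_ * expR _).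
case: n => [|n]; first by rewrite ln1 mulr0 mul0r mulr0.
by rewrite mulrC divfK // pnatr_eq0.
Qed.

Lemma texp1X n : texp 1 n ^+ n = 2 ^+ n * n.+1%:R.
Proof. by rewrite texpX mul1r lnK // posrE ltr0n. Qed.

Lemma texpN1X n : texp (-1) n ^+ n = 2 ^+ n / n.+1%:R.
Proof. by rewrite texpX mulN1r expRN lnK // posrE ltr0n. Qed.

(** The decay of the shear coefficients divides a power of 2 by two linear factors and still needs
    linear growth, hence a cube. Equality holds at [n = 2]. *)
Lemma cube_le_exp2 n : (n.+2 ^ 3 <= 16 * 2 ^ n)%N.
Proof.
elim: n => [|n IH] //; case: n IH => [|[|n]] // IH.
have E : (n.+1.+4 ^ 3 <= 2 * n.+4 ^ 3)%N by rewrite !expnS expn0; nia.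
by rewrite (expnS 2) mulnCA (leq_trans E) // leq_mul2l.
Qed.

Variable c : R.
Hypothesis c01 : 0 < c < 1.

Let L := - ln c.

Let L_gt0 : 0 < L.
Proof. by rewrite oppr_gt0 ln_lt0. Qed.

Definition coef (s : R) (n : nat) : R := powR c (texp s n ^+ n).

Lemma coefE s n : coef s n = expR (- (L * texp s n ^+ n)).
Proof.
have /andP[c0 _] := c01.
by rewrite /coef /powR gt_eqF // /L mulNr opprK mulrC.
Qed.

Lemma coef_gt0 s n : 0 < coef s n.
Proof. by rewrite coefE expR_gt0. Qed.

Lemma ln_coef s n : ln (coef s n) = - (L * texp s n ^+ n).
Proof. by rewrite coefE expRK. Qed.

Lemma coef_small s : (forall n, n.+1%:R / 16 <= texp s n ^+ n) ->
  exists J, forall n, (J <= n)%N -> coef s n <= 1 / 4.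
Proof.
move=> H; exists (Num.truncn (16 * ln 4 / L)).+1 => n nn.
rewrite -ler_ln ?posrE ?coef_gt0 // ln_coef mul1r lnV ?posrE // lerN2.
have : 16 * ln 4 / L <= n.+1%:R.
  by rewrite (le_trans (ltW (truncnS_gt _))) // ler_nat leqW.
rewrite ler_pdivrMr // => n16; have := ler_wpM2l (ltW L_gt0) (H n).
move: n16; lra.
Qed.

Lemma basinE s : basin c (texp s) = orbit_basin (coef s).
Proof.
have E p : (fun n => Phi c (texp s) n p) = (fun n => horbit (coef s) n p).
  by apply/funext; elim=> [|n IH] //=; rewrite IH.
by apply/seteqP; split=> p; rewrite /basin /orbit_basin /= E.
Qed.

(** Here [log a_n / 2^n = - L (n + 1)]: the factor [n + 1] increases, which gives
    [a_(n+1) <= a_n ^ 2], and is unbounded, which gives the pole at the origin. *)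
Lemma short_coef : short_C2 (orbit_basin (coef 1)).
Proof.
have [n|J HJ] := @coef_small 1.
  rewrite texp1X; have : 1 <= 2 ^+ n :> R by rewrite exprn_ege1 // ler1n.
  have : 0 <= n.+1%:R :> R by exact: ler0n.
  by move: (2 ^+ n) n.+1%:R => x y; nra.
apply: (@short_basin R (coef 1) J (coef_gt0 1) HJ).
  move=> n _; rewrite -ler_ln ?posrE ?exprn_gt0 ?coef_gt0 // lnXn ?coef_gt0 //.
  rewrite !ln_coef !texp1X mulNrn lerN2 -mulrnAr ler_wpM2l ?(ltW L_gt0) //.
  by rewrite exprS -mulr_natl mulrA ler_wpM2l ?mulr_ge0 ?exprn_ge0 // ler_nat.
move=> K; have fin (A l y M x : R) : 0 < M -> A <= l -> l - K <= x -> x < y * M ->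
  A - M * (y + 1) < K by clear; lra.
pose n := (Num.truncn ((`|ln 2 - K|) / L)).+1.
exists (maxn J n); first exact: leq_maxl.
set m := maxn J n; have nm_ : (n <= m)%N by exact: leq_maxr.
rewrite lnM ?posrE ?coef_gt0 // ln_coef texp1X.
have p2 : 1 <= 2 ^+ m :> R by rewrite exprn_ege1 // ler1n.
have p20 : 0 < 2 ^+ m :> R by rewrite exprn_gt0.
have : `|ln 2 - K| / L < m%:R.
  by rewrite (lt_le_trans (truncnS_gt _)) // ler_nat.
rewrite ltr_pdivrMr // => H; have := ler_norm (ln 2 - K) => H'.
have l2 : 0 <= ln 2 :> R by rewrite ln_ge0 // ler1n.
rewrite mulrDl mulNr mulrCA mulrAC mulfV ?gt_eqF // mul1r.
have : ln 2 / 2 ^+ m <= ln 2 :> R by rewrite ler_pdivrMr // ler_peMr.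
by rewrite -[m.+1%:R]natr1 => A2; apply: fin L_gt0 A2 H' H.
Qed.

Lemma fatou_bieberbach_coef : fatou_bieberbach (orbit_basin (coef (-1))).
Proof.
have cube n : n.+2%:R ^+ 3 <= 16 * 2 ^+ n :> R.
  by rewrite -!natrX -natrM ler_nat cube_le_exp2.
have tau_ge n : n.+1%:R / 16 <= texp (-1) n ^+ n.
  rewrite texpN1X ler_pdivlMr ?ltr0n //; have := cube n; rewrite -natr1.
  have : 0 < n.+1%:R :> R by rewrite ltr0n.
  by move: (n.+1%:R : R) => x; nra.
have [J1 HJ1] := coef_small tau_ge.
pose N := maxn J1 (Num.truncn (8 * ln 4 / L)).+1.
apply: (@basin_fatou_bieberbach R (coef (-1)) (coef_gt0 (-1)) N).
- move=> n Nn; have cg := coef_gt0 (-1).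
  (* The decay of the shear coefficients reduces to [4 a_(n+1)^2 <= a_(n+2)]. *)
  have G (P x y : R) : 0 < P -> 0 < x -> 0 < y -> 4 * x ^+ 2 <= y -> P * x / y <= P / x / 4.
    move=> P0 x0 y0 xy; rewrite ler_pdivrMr //.
    have -> : P / x / 4 * y = P * (y / (4 * x)) by field; rewrite gt_eqF.
    by rewrite ler_pM2l // ler_pdivlMr ?mulr_gt0 //; lra.
  rewrite /shear_coef /coef_prod big_ord_recr /= -/(coef_prod (coef (-1)) n).
  apply: G => //; first exact: coef_prod_gt0.
  rewrite -ler_ln ?posrE ?mulr_gt0 ?exprn_gt0 // lnM ?posrE ?exprn_gt0 // lnXn //.
  rewrite !ln_coef !texpN1X.
  have : 8 * ln 4 / L <= n%:R.
    rewrite (le_trans (ltW (truncnS_gt _))) // ler_nat (leq_trans _ Nn) //.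
    exact: leq_maxr.
  rewrite ler_pdivrMr // => n8.
  have := cube n.+1; rewrite -[n.+3%:R]natr1 [2 ^+ n.+2]exprS [2 ^+ n.+1]exprS.
  have : n%:R + 2 = n.+2%:R :> R by rewrite -!natr1; ring.
  have : 0 <= n%:R :> R by exact: ler0n.
  move: (2 ^+ n : R) (n%:R : R) (n.+2%:R : R) n8 => z y x n8 y0 <- cub.
  set t1 := 2 * z / (y + 2); set t2 := 2 * (2 * z) / (y + 2 + 1).
  (* The difference is [2^(n+2) / ((n+2) (n+3))], and the cubic bound leaves a linear lower bound;
     by the choice of [N], [L] times it is at least [ln 4]. *)
  have D : (y + 2 + 1) / 8 <= 2 * t1 - t2.
    have -> : 2 * t1 - t2 = 4 * z / ((y + 2) * (y + 2 + 1)).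
      by rewrite /t1 /t2; field; apply/andP; split; apply: lt0r_neq0; lra.
    rewrite ler_pdivlMr; first by nra.
    by rewrite mulr_gt0 //; lra.
  have fin (u v M l d : R) : l <= d * M / 8 -> M * d <= M * (2 * u - v) * 8 -> l + - (M
      * u) *+ 2 <= - (M * v).
    by lra.
  apply: (fin _ _ _ _ (y + 2 + 1)).
    by have := L_gt0; lra.
  by have := ler_wpM2l (ltW L_gt0) D; lra.
- by move=> n Nn; apply: HJ1; rewrite (leq_trans _ Nn) // leq_maxl.
- move=> n.
  (* The condition becomes [L 2^(n+1) <= ln 2 (n + k + 2)]: the denominator in the exponent
     [2^n / (n + 1)] beats any constant. *)
  pose k := (Num.truncn (L * 2 ^+ n.+1 / ln 2)).+1; exists k.
  have l2 : 0 < ln 2 :> R by rewrite ln_gt0 // ltr1n.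
  have h0 : 0 < 1 / 2 :> R by rewrite divr_gt0.
  rewrite -ler_ln ?posrE ?exprn_gt0 ?coef_gt0 // lnXn // ln_coef texpN1X.
  rewrite mul1r lnV ?posrE // mulNrn lerN2.
  have : L * 2 ^+ n.+1 / ln 2 < k%:R by exact: truncnS_gt.
  rewrite ltr_pdivrMr // => H.
  have kk : k%:R <= (n + k).+2%:R :> R by rewrite ler_nat (leq_trans (leq_addl n k)) //
      leqW.
  have {}H : L * 2 ^+ n.+1 <= ln 2 * (n + k).+2%:R.
    by rewrite (le_trans (ltW H)) // mulrC ler_wpM2l // ltW.
  rewrite mulrA ler_pdivrMr ?ltr0n // -[ln 2 *+ _]mulr_natr natrX.
  by rewrite -addSn exprD mulrA [leRHS]mulrAC ler_wpM2r // exprn_ge0.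
Qed.
End exponents.

Unset Implicit Arguments.

Theorem theorem1p7 (R : realType) (c : R) :
  0 < c < 1 ->
  (exists t : nat -> R,
      [/\ (forall n, 0 < t n), t @ \oo --> (2 : R) & short_C2 (basin c t)]) /\
  (exists t : nat -> R,
      [/\ (forall n, 0 < t n), t @ \oo --> (2 : R) & fatou_bieberbach (basin c t)]).
Proof.
move=> c01; split; [exists (texp 1)|exists (texp (-1))].
  by split; [exact: texp_gt0|exact: texp_cvg|rewrite basinE; exact: short_coef].
by split; [exact: texp_gt0|exact: texp_cvg|rewrite basinE; exact: fatou_bieberbach_coef].
Qed.
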